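(* Let $b\in\mathbb{R}$ with $|b|<1$. Consider an $s$-stage IMEX-RK scheme $(\tilde A,\vec{\tilde b},A,\vec b)$ of type CK and implicitly stiffly accurate (ISA), for which there exists a real $s\times s$ matrix $M$ satisfying (M1) and (M2). Let $c_{CFL}>0$ be any fixed number and let $T>0$. Then there exist positive constants $c$ and $C$, independent of $\varepsilon$, $N$ and $\Delta t$, such that the following holds. For every $\varepsilon>0$, every integer $N\ge 1$, every $\Delta t>0$ with $$\Delta t\le \min\Big(\frac{c_{CFL}}{N^2},\,c\Big),$$ and all real-valued $2\pi$-periodic $u_{in},w_{in}\in L^2[0,2\pi]$, the solution $(U_N^n,W_N^n)$ of the fully discrete scheme with initial condition $U_N^0=\mathcal{P}_N u_{in}$, $W_N^0=\mathcal{P}_N w_{in}$ satisfies $$(1-b^2)\|U_N^n\|^2+\|W_N^n\|^2\le C\big((1-b^2)\|u_{in}\|^2+\|w_{in}\|^2\big)$$ for all integers $n\ge 0$ with $n\Delta t\le T$.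
   Context: The underlying PDE, for $x\in[0,2\pi]$ with periodic boundary condition, is $$\partial_t u+\partial_x(bu+w)=0,\qquad \partial_t w+\partial_x((1-b^2)u-bw)=-\frac1\varepsilon w,\qquad \varepsilon>0.$$ $\|\cdot\|$ is the $L^2$ norm in $x$ over $[0,2\pi]$. $\mathbb{P}_N=\mathrm{span}\{e^{ikx}:-N\le k\le N\}$ and $\mathcal{P}_N$ is the $L^2$-orthogonal projection onto $\mathbb{P}_N$. IMEX-RK scheme: $\tilde A=(\tilde a_{ij})\in\mathbb{R}^{s\times s}$ is strictly lower-triangular, $A=(a_{ij})\in\mathbb{R}^{s\times s}$ is lower-triangular, $\vec{\tilde b}=(\tilde b_1,\dots,\tilde b_s)$, $\vec b=(b_1,\dots,b_s)$ are real vectors. (The scalar $b$ without subscript is the PDE coefficient.) Type CK: $s\ge 2$ and $A=\begin{pmatrix}0&0\\ \vec a&\hat A\end{pmatrix}$ with $\vec a\in\mathbb{R}^{s-1}$ and $\hat A\in\mathbb{R}^{(s-1)\times(s-1)}$ invertible. ISA: $a_{si}=b_i$ for $i=1,\dots,s$. Fully discrete scheme (Fourier-Galerkin in $x$): given $U_N^n,W_N^n\in\mathbb{P}_N$, the stages $U_N^{(i)},W_N^{(i)}\in\mathbb{P}_N$, $i=1,\dots,s$, and the update are defined by $$U_N^{(i)}=U_N^n-\Delta t\sum_{j=1}^{i-1}\tilde a_{ij}(b\,\partial_xU_N^{(j)}+\partial_xW_N^{(j)}),$$ $$W_N^{(i)}=W_N^n-\Delta t\sum_{j=1}^{i-1}\tilde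 a_{ij}((1-b^2)\partial_xU_N^{(j)}-b\,\partial_xW_N^{(j)})-\frac{\Delta t}{\varepsilon}\sum_{j=1}^{i}a_{ij}W_N^{(j)},$$ $$U_N^{n+1}=U_N^n-\Delta t\sum_{j=1}^{s}\tilde b_j(b\,\partial_xU_N^{(j)}+\partial_xW_N^{(j)}),$$ $$W_N^{n+1}=W_N^n-\Delta t\sum_{j=1}^{s}\tilde b_j((1-b^2)\partial_xU_N^{(j)}-b\,\partial_xW_N^{(j)})-\frac{\Delta t}{\varepsilon}\sum_{j=1}^{s}b_jW_N^{(j)}.$$ For a real $s\times s$ matrix $M$ define $M_*:=MJ+\mathrm{diag}(1,0,\dots,0,-1)$, where $J$ is the $s\times s$ matrix whose first row is zero and whose $i$-th row, $i\ge2$, has $-1$ in column $1$, $1$ in column $i$ and zeros elsewhere. Conditions: (M1) $MA+(MA)^\top$ is positive semi-definite and has rank $s-1$. (M2) $M_*+M_*^\top$ is positive semi-definite and has rank $s-1$. *)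

(* Defs.v *)
From HB Require Import structures.
From mathcomp Require Import all_boot all_order all_algebra.
From mathcomp Require Import complex.
From mathcomp Require Import all_classical all_reals all_analysis.

Set Implicit Arguments.
Unset Strict Implicit.
Unset Printing Implicit Defensive.

Import Order.TTheory GRing.Theory Num.Theory.
Import numFieldNormedType.Exports.

Local Open Scope classical_set_scope.
Local Open Scope complex_scope.
Local Open Scope ring_scope.

Section Fourier.
Context {R : realType}.
Implicit Types (f g : R -> R[i]) (u : R -> R).

Definition period_itv : set R := `[0, 2 * pi].

(* The restriction [f \_ D] is [0] outside [D], so the [L^2] norm over the real
   line used here is the one over [0, 2 pi]; it is extended-real valued. *)
Definition L2fun u : Prop :=
  u \_ period_itv \in Lfun (@lebesgue_measure R) 2%:E.

Definition L2norm f : \bar R :=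
  'N[@lebesgue_measure R]_2%:E[
    (fun x => (ComplexField.Normc.normc (f x))%:E) \_ period_itv].

Definition L2inner f g : R[i] :=
  (\int[@lebesgue_measure R]_(x in period_itv) complex.Re (f x * (g x)^*)) +i*
  (\int[@lebesgue_measure R]_(x in period_itv) complex.Im (f x * (g x)^*)).

Definition dx f : R -> R[i] := fun x =>
  (derive1 (fun y => complex.Re (f y)) x) +i*
  (derive1 (fun y => complex.Im (f y)) x).

(* [e^{ikx}] *)
Definition expix (k : int) : R -> R[i] := fun x =>
  (cos (k%:~R * x)) +i* (sin (k%:~R * x)).

(* The complex span; the index [j] stands for the wave number [k = j - N],
   which ranges over [-N, ..., N]. *)
Definition in_PN (N : nat) f : Prop :=
  exists c : int -> R[i],
    forall x, f x =
      \sum_(j < N.*2.+1) c (j%:Z - N%:Z) * expix (j%:Z - N%:Z) x.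

Definition is_projPN (N : nat) f g : Prop :=
  in_PN N g /\
  forall h, in_PN N h -> L2inner (fun x => f x - g x) h = 0.

End Fourier.

Section IMEX.
Context {R : realType}.

(* Stages are numbered from 0, so that stage [i] is [i : 'I_s] with value
   one less than in the mathematical numbering. *)
Record imex_rk (s : nat) := ImexRK {
  exA : 'M[R]_s;
  exb : 'rV[R]_s;
  imA : 'M[R]_s;
  imb : 'rV[R]_s;
  exA_strict_trig : forall i j : 'I_s, (i <= j)%N -> exA i j = 0;
  imA_trig : is_trig_mx imA }.

Definition type_CK r (rk : imex_rk r.+2) : Prop :=
  exists (a : 'cV[R]_r.+1) (Ahat : 'M[R]_r.+1),
    Ahat \in unitmx /\
    imA rk = block_mx (0 : 'M[R]_1) 0 a Ahat :> 'M[R]_(1 + r.+1).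

Definition ISA r (rk : imex_rk r.+2) : Prop :=
  forall i, imA rk ord_max i = imb rk 0 i.

Definition psd s (Q : 'M[R]_s) : Prop :=
  Q^T = Q /\ forall x : 'cV[R]_s, 0 <= (x^T *m Q *m x) 0 0.

Definition Jmx r : 'M[R]_r.+2 :=
  \matrix_(i, j) if i == ord0 then 0 else (j == i)%:R - (j == ord0)%:R.

Definition Mstar r (M : 'M[R]_r.+2) : 'M[R]_r.+2 :=
  M *m Jmx r + diag_mx (\row_j ((j == ord0)%:R - (j == ord_max)%:R)).

Definition condM1 r (rk : imex_rk r.+2) (M : 'M[R]_r.+2) : Prop :=
  let Q := M *m imA rk + (M *m imA rk)^T in psd Q /\ \rank Q = r.+1.

Definition condM2 r (M : 'M[R]_r.+2) : Prop :=
  let Q := Mstar M + (Mstar M)^T in psd Q /\ \rank Q = r.+1.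

Definition dx_fluxU (b : R) (u w : R -> R[i]) : R -> R[i] := fun x =>
  b%:C * dx u x + dx w x.

Definition dx_fluxW (b : R) (u w : R -> R[i]) : R -> R[i] := fun x =>
  (1 - b ^+ 2)%:C * dx u x - b%:C * dx w x.

Definition imex_step s (rk : imex_rk s) (b eps dt : R) (N : nat)
    (U W : R -> R[i]) (Us Ws : 'I_s -> R -> R[i]) (U' W' : R -> R[i]) : Prop :=
  [/\ forall i, in_PN N (Us i) /\ in_PN N (Ws i),
      forall i x, Us i x = U x
        - dt%:C * \sum_(j < s | (j < i)%N)
            (exA rk i j)%:C * dx_fluxU b (Us j) (Ws j) x,
      forall i x, Ws i x = W x
        - dt%:C * \sum_(j < s | (j < i)%N)
            (exA rk i j)%:C * dx_fluxW b (Us j) (Ws j) x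
        - (dt / eps)%:C * \sum_(j < s | (j <= i)%N) (imA rk i j)%:C * Ws j x,
      forall x, U' x = U x
        - dt%:C * \sum_(j < s) (exb rk 0 j)%:C * dx_fluxU b (Us j) (Ws j) x
    & forall x, W' x = W x
        - dt%:C * \sum_(j < s) (exb rk 0 j)%:C * dx_fluxW b (Us j) (Ws j) x
        - (dt / eps)%:C * \sum_(j < s) (imb rk 0 j)%:C * Ws j x].

Definition imex_solution s (rk : imex_rk s) (b eps dt : R) (N : nat)
    (uin win : R -> R) (U W : nat -> R -> R[i]) : Prop :=
  [/\ is_projPN N (fun x => (uin x)%:C) (U 0%N),
      is_projPN N (fun x => (win x)%:C) (W 0%N)
    & forall n, [/\ in_PN N (U n), in_PN N (W n)
        & exists Us Ws : 'I_s -> R -> R[i],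
            imex_step rk b eps dt N (U n) (W n) Us Ws (U n.+1) (W n.+1)]].

Definition energy (b : R) (u w : R -> R[i]) : \bar R :=
  ((1 - b ^+ 2)%:E * L2norm u ^+ 2 + L2norm w ^+ 2)%E.

End IMEX.

Arguments imex_rk R s : clear implicits.

(* Main.v *)
Require Import Defs.
From HB Require Import structures.
From mathcomp Require Import all_boot all_order all_algebra.
From mathcomp Require Import complex.
From mathcomp Require Import all_classical all_reals all_analysis.
From mathcomp Require Import measurable_realfun.
From mathcomp Require Import ring lra.

Set Implicit Arguments.
Unset Strict Implicit.
Unset Printing Implicit Defensive.

Import Order.TTheory GRing.Theory Num.Theory.
Import numFieldNormedType.Exports.

Local Open Scope classical_set_scope.
Local Open Scope complex_scope.
Local Open Scope ring_scope.

(** The Fourier modes decouple. On mode k put theta = k dt and sigma = dt / eps.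
    With d = J W the deviation of the w-stages from the first one,
    J W = - i theta (exA G) - sigma (A W), so pairing with M W gives
      |w_s|^2 = |w|^2 - W^* (M_* + M_*^T) W / 2 - sigma W^* (MA + (MA)^T) W / 2
                + theta Re (- i W^* M exA G).
    (M1) makes the sigma term harmless for every sigma, and (M2) bounds |d|^2 by
    the first quadratic form, whose kernel is spanned by (1, ..., 1). That kernel
    also fixes all column sums of M but the first, so the terms of order theta in
    the energy balance cancel up to multiples of |d|; Young's inequality then
    yields E' <= (1 + K theta^2) E for |theta| small. Finally
    theta^2 <= N^2 dt^2 <= c_CFL dt, so n steps amplify the energy by at most
    exp (K c_CFL T), and Parseval's identity sums over the modes. *)

(** * Matrix estimates *)

Section EntrywiseNorm.
Context {R : numDomainType}.

(** The sum of absolute entries is submultiplicative for every shape, so stage vectors, rows and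
    matrices share one calculus of bounds. Sharp constants are irrelevant here. *)
Definition l1norm m n (A : 'M[R]_(m, n)) : R := \sum_i \sum_j `|A i j|.

Lemma l1norm_ge0 m n (A : 'M[R]_(m, n)) : 0 <= l1norm A.
Proof. by apply: sumr_ge0 => i _; apply: sumr_ge0. Qed.

Lemma entry_le_l1norm m n (A : 'M[R]_(m, n)) i j : `|A i j| <= l1norm A.
Proof.
rewrite /l1norm (bigD1 i) //= (bigD1 j) //= -addrA lerDl addr_ge0 //.
  by apply: sumr_ge0.
by apply: sumr_ge0 => k _; apply: sumr_ge0.
Qed.

Lemma l1normD m n (A B : 'M[R]_(m, n)) : l1norm (A + B) <= l1norm A + l1norm B.
Proof.
rewrite -big_split; apply: ler_sum => i _; rewrite -big_split.
by apply: ler_sum => j _; rewrite mxE ler_normD.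
Qed.

Lemma l1normZ m n a (A : 'M[R]_(m, n)) : l1norm (a *: A) = `|a| * l1norm A.
Proof.
rewrite mulr_sumr; apply: eq_bigr => i _; rewrite mulr_sumr.
by apply: eq_bigr => j _; rewrite mxE normrM.
Qed.

Lemma l1normN m n (A : 'M[R]_(m, n)) : l1norm (- A) = l1norm A.
Proof. by rewrite -scaleN1r l1normZ normrN1 mul1r. Qed.

Lemma l1norm_tr m n (A : 'M[R]_(m, n)) : l1norm A^T = l1norm A.
Proof.
rewrite /l1norm exchange_big; apply: eq_bigr => i _.
by apply: eq_bigr => j _; rewrite mxE.
Qed.

Lemma l1norm_const n (a : R) : l1norm (const_mx a : 'cV_n) = n%:R * `|a|.
Proof.
rewrite /l1norm; under eq_bigr do rewrite big_ord1 mxE.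
by rewrite sumr_const card_ord mulr_natl.
Qed.

Lemma l1normM m n p (A : 'M[R]_(m, n)) (B : 'M[R]_(n, p)) :
  l1norm (A *m B) <= l1norm A * l1norm B.
Proof.
rewrite mulr_suml; apply: ler_sum => i _.
apply: (@le_trans _ _ (\sum_k \sum_j `|A i j| * `|B j k|)).
  apply: ler_sum => k _; rewrite mxE.
  by apply: le_trans (ler_norm_sum _ _ _) _; under eq_bigr do rewrite normrM.
rewrite exchange_big mulr_suml; apply: ler_sum => j _.
rewrite -mulr_sumr ler_wpM2l // /l1norm (bigD1 j) //= lerDl.
by apply: sumr_ge0 => k _; apply: sumr_ge0.
Qed.

End EntrywiseNorm.

(** * Positive semi-definite forms and coercivity modulo the kernel *)

Section Psd.
Context {R : realType}.

Lemma bformDl n (Q : 'M[R]_n) (x y z : 'cV[R]_n) :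
  ((x + y)^T *m Q *m z) 0 0 = (x^T *m Q *m z) 0 0 + (y^T *m Q *m z) 0 0.
Proof. by rewrite linearD /= !mulmxDl [LHS]mxE. Qed.

Lemma bformDr n (Q : 'M[R]_n) (x y z : 'cV[R]_n) :
  (x^T *m Q *m (y + z)) 0 0 = (x^T *m Q *m y) 0 0 + (x^T *m Q *m z) 0 0.
Proof. by rewrite mulmxDr [LHS]mxE. Qed.

Lemma bformZl n (Q : 'M[R]_n) a (x y : 'cV[R]_n) :
  ((a *: x)^T *m Q *m y) 0 0 = a * (x^T *m Q *m y) 0 0.
Proof. by rewrite linearZ /= -!scalemxAl [LHS]mxE. Qed.

Lemma bformZr n (Q : 'M[R]_n) a (x y : 'cV[R]_n) :
  (x^T *m Q *m (a *: y)) 0 0 = a * (x^T *m Q *m y) 0 0.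
Proof. by rewrite -scalemxAr [LHS]mxE. Qed.

Lemma bform_tr n (Q : 'M[R]_n) (x y : 'cV[R]_n) :
  (x^T *m Q^T *m y) 0 0 = (y^T *m Q *m x) 0 0.
Proof.
have <- : (y^T *m Q *m x)^T = x^T *m Q^T *m y by rewrite !trmx_mul trmxK mulmxA.
by rewrite mxE.
Qed.

(** The form is nonnegative along the line x + t y, hence its discriminant in t is nonpositive. The
    degenerate case c = 0 is treated apart. *)
Lemma psd_cauchy_schwarz n (Q : 'M[R]_n) (x y : 'cV[R]_n) : psd Q ->
  ((x^T *m Q *m y) 0 0) ^+ 2 <= (x^T *m Q *m x) 0 0 * (y^T *m Q *m y) 0 0.
Proof.
move=> [symQ posQ].
set a := (x^T *m Q *m x) 0 0; set c := (y^T *m Q *m y) 0 0.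
set d := (x^T *m Q *m y) 0 0.
have dC : (y^T *m Q *m x) 0 0 = d by rewrite -bform_tr symQ.
have quad t : 0 <= a + 2 * t * d + t ^+ 2 * c.
  have := posQ (x + t *: y).
  rewrite !(bformDl, bformDr, bformZl, bformZr) dC -/a -/c -/d.
  by lra.
have a0 : 0 <= a by apply: posQ.
have c0 : 0 <= c by apply: posQ.
have [c_eq0|c_neq0] := eqVneq c 0.
  have [d_eq0|d_neq0] := eqVneq d 0; first by rewrite d_eq0 expr0n mulr_ge0.
  (* With c = 0 the polynomial is affine in t, and this t would give it the value -1. *)
  have := quad (- (a + 1) / (2 * d)); rewrite c_eq0 mulr0 addr0.
  have -> : 2 * (- (a + 1) / (2 * d)) * d = - (a + 1) by field.
  by lra.
have := quad (- d / c).
have -> : a + 2 * (- d / c) * d + (- d / c) ^+ 2 * c = (a * c - d ^+ 2) / c.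
  by field.
by rewrite pmulr_lge0 ?invr_gt0 ?lt_def ?c_neq0 // subr_ge0.
Qed.

(** Cauchy-Schwarz against each basis vector makes every entry of Q x vanish. *)
Lemma psd_kernel n (Q : 'M[R]_n) (x : 'cV[R]_n) : psd Q ->
  (x^T *m Q *m x) 0 0 = 0 -> Q *m x = 0.
Proof.
move=> psdQ x0; apply/colP => i.
have := psd_cauchy_schwarz (delta_mx i 0) x psdQ.
rewrite x0 mulr0 => le0.
have : ((delta_mx i 0 : 'cV[R]_n)^T *m Q *m x) 0 0 = 0.
  by apply/eqP; rewrite -sqrf_eq0 eq_le le0 sqr_ge0.
by rewrite trmx_delta -mulmxA -rowE !mxE.
Qed.

(* A linear map killing the kernel of Q factors as Y *m Q, so Cauchy-Schwarz for
   the form Q bounds it without any compactness argument. *)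
Lemma psd_coercive n m (Q : 'M[R]_n) (B : 'M[R]_(m, n)) (v : 'cV[R]_n) :
  psd Q -> v != 0 -> Q *m v = 0 -> \rank Q = n.-1 -> B *m v = 0 ->
  exists2 K : R, 0 <= K &
    forall x : 'cV[R]_n, l1norm (B *m x) ^+ 2 <= K * (x^T *m Q *m x) 0 0.
Proof.
move=> psdQ v0 Qv rkQ Bv.
(* The row space of Q lies in the left kernel of v and both have rank n - 1, so they coincide; B v =
   0 places the rows of B in it. *)
have /submxP [Y BYQ] : (B <= Q)%MS.
  have QB : (Q <= kermx v)%MS by apply/sub_kermxP.
  have rkv : \rank v = 1%N.
    by apply/eqP; rewrite eqn_leq rank_leq_col lt0n mxrank_eq0.
  have /eqmxP eqQ : (Q == kermx v)%MS.
    by rewrite -(mxrank_leqif_eq QB).2 rkQ mxrank_ker rkv subn1.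
  by rewrite eqQ; apply/sub_kermxP.
(* [q i] is the squared Q-length of row i of Y. Entry i of B x is the Q-product of that row with x,
   hence at most the product of their Q-lengths. *)
pose q i := ((row i Y) *m Q *m (row i Y)^T) 0 0.
pose K := \sum_i Num.sqrt (q i).
have K0 : 0 <= K by apply: sumr_ge0 => i _; apply: sqrtr_ge0.
exists (K ^+ 2); first by rewrite sqr_ge0.
move=> x; have [symQ posQ] := psdQ.
have X0 := posQ x; set X := (x^T *m Q *m x) 0 0 in X0 *.
rewrite -[X in _ * X](sqr_sqrtr X0) -exprMn lerXn2r ?nnegrE ?l1norm_ge0 //.
  by rewrite mulr_ge0 ?sqrtr_ge0.
rewrite mulr_suml; apply: ler_sum => i _; rewrite big_ord1.
have qE : q i = ((((row i Y)^T)^T) *m Q *m (row i Y)^T) 0 0 by rewrite trmxK.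
have qi0 : 0 <= q i by rewrite qE; apply: posQ.
rewrite -sqrtrM // -sqrtr_sqr; apply: ler_wsqrtr.
have := psd_cauchy_schwarz (row i Y)^T x psdQ.
rewrite -qE -/X; apply: le_trans; rewrite le_eqVlt; apply/orP; left; apply/eqP; congr (_ ^+ 2).
by rewrite trmxK BYQ -!row_mul [RHS]mxE.
Qed.

End Psd.

(** * Algebraic consequences of (M1) and (M2) for the w-stages *)

Section Energy.
Context {R : realType} {r : nat}.
Implicit Types (M : 'M[R]_r.+2) (rk : imex_rk R r.+2) (W G : 'cV[R]_r.+2).

Local Notation ones := (const_mx 1 : 'cV[R]_r.+2).

Lemma Jmx_mulE (x : 'cV[R]_r.+2) : Jmx r *m x = x - const_mx (x ord0 0).
Proof.
apply/colP => i; rewrite !mxE; have [->|i0] := eqVneq i ord0.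
  by rewrite subrr big1 // => j _; rewrite !mxE eqxx mul0r.
under eq_bigr => j _ do rewrite mxE (negbTE i0) mulrBl.
rewrite sumrB (bigD1 i) //= eqxx mul1r big1 ?addr0; last first.
  by move=> j /negbTE ->; rewrite mul0r.
congr (_ - _); rewrite (bigD1 ord0) //= mul1r big1 ?addr0 // => j.
by move=> /negbTE; rewrite -!val_eqE /= => ->; rewrite mul0r.
Qed.

Lemma trJmx_mulE (y : 'cV[R]_r.+2) i : i != ord0 -> ((Jmx r)^T *m y) i 0 = y i 0.
Proof.
move=> i0; rewrite mxE (bigD1 i) //= big1 ?addr0; last first.
  move=> j ji; rewrite !mxE; case: ifP => _; first by rewrite mul0r.
  by rewrite eq_sym (negbTE ji) (negbTE i0) subrr mul0r.
by rewrite !mxE (negbTE i0) eqxx subr0 mul1r.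
Qed.

Lemma Jmx_ones : Jmx r *m ones = 0 :> 'cV[R]_r.+2.
Proof. by rewrite Jmx_mulE mxE subrr. Qed.

Lemma Mstar_ones M :
  Mstar M *m ones = \col_j ((j == ord0)%:R - (j == ord_max)%:R).
Proof.
rewrite /Mstar mulmxDl -mulmxA Jmx_ones mulmx0 add0r.
by apply/colP => i; rewrite mul_diag_mx !mxE mulr1.
Qed.

(** J kills the constant vector and the diagonal correction 1, 0, ..., 0, -1 sums to zero, so the
    semi-definite form vanishes at [ones], which is therefore in its kernel. *)
Lemma condM2_ones M : condM2 M -> (Mstar M + (Mstar M)^T) *m ones = 0.
Proof.
move=> [psdQ _]; apply: psd_kernel => //.
suff s0 : (ones^T *m Mstar M *m ones) 0 0 = 0.
  by rewrite mulmxDr mulmxDl mxE bform_tr s0 addr0.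
rewrite -mulmxA Mstar_ones mxE; under eq_bigr => j _ do rewrite !mxE mul1r.
by rewrite sumrB -!natr_sum -!big_mkcond !big_pred1_eq subrr.
Qed.

(* The kernel relation (M_* + M_*^T) 1 = 0 reads J^T (M^T 1) = 2 (e_s - e_1). *)
Lemma condM2_colsum M i : condM2 M -> i != ord0 ->
  (M^T *m ones) i 0 = 2 * (i == ord_max)%:R.
Proof.
move=> cM2 i0; have /colP/(_ i) := condM2_ones cM2.
rewrite mulmxDl Mstar_ones /Mstar linearD /= tr_diag_mx mulmxDl trmx_mul -mulmxA.
rewrite mxE mxE (negbTE i0) sub0r mxE trJmx_mulE // mul_diag_mx !mxE (negbTE i0).
rewrite mulr0n; set x := \sum_j _; set t := _%:R; lra.
Qed.

(** All column sums of M but the first are known: 2 in the last column, 0 elsewhere. The unknown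
    first one meets the entry of y that vanishes, as it does for every y in the range of [exA]. *)
Lemma condM2_first_order M (y : 'cV[R]_r.+2) : condM2 M -> y ord0 0 = 0 ->
  (ones^T *m M *m y) 0 0 = 2 * y ord_max 0.
Proof.
move=> cM2 y0; rewrite -[ones^T *m M]trmxK trmx_mul trmxK mxE.
rewrite (bigD1 ord_max) //= mxE condM2_colsum // eqxx mulr1 big1 ?addr0 // => i im.
have [->|i0] := eqVneq i ord0; first by rewrite y0 mulr0.
by rewrite mxE condM2_colsum // (negbTE im) mulr0 mul0r.
Qed.

Lemma exA_row0 rk (y : 'cV[R]_r.+2) : (exA rk *m y) ord0 0 = 0.
Proof. by rewrite mxE big1 // => j _; rewrite exA_strict_trig // mul0r. Qed.

(** Type CK gives [imA] a zero first row. Together with the zero first row of [exA], it makes the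
    first w-stage equal to the old value w. *)
Lemma imA_row0 rk (y : 'cV[R]_r.+2) : type_CK rk -> (imA rk *m y) ord0 0 = 0.
Proof.
move=> [a [Ahat [_ ->]]]; rewrite mxE big1 // => j _.
rewrite mxE; case: splitP => // k _; rewrite mxE.
by case: splitP => l _; rewrite mxE mul0r.
Qed.

(** Real form of the energy identity. The term in [sigma] has a favourable sign by (M1) and is
    dropped whatever its size; this is the source of uniformity in epsilon. *)
Lemma stage_energy rk M (W G : 'cV[R]_r.+2) (w theta sigma : R) :
  type_CK rk -> condM1 rk M -> 0 <= sigma ->
  W = const_mx w + theta *: (exA rk *m G) - sigma *: (imA rk *m W) ->
  W ord_max 0 ^+ 2 <= w ^+ 2
    - (W^T *m (Mstar M + (Mstar M)^T) *m W) 0 0 / 2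
    + theta * (W^T *m M *m (exA rk *m G)) 0 0.
Proof.
move=> hCK [[_ posQ1] _] sigma0 eqW.
have W0 : W ord0 0 = w.
  rewrite eqW; move: (exA_row0 rk G) (imA_row0 W hCK); rewrite !mxE => -> ->.
  by rewrite !mulr0 subr0 addr0.
have JW : Jmx r *m W = theta *: (exA rk *m G) - sigma *: (imA rk *m W).
  by rewrite Jmx_mulE W0 {1}eqW; apply/eqP; rewrite subr_eq -addrA addrC.
have Q1 := posQ1 W.
have Q1E : (W^T *m (M *m imA rk + (M *m imA rk)^T) *m W) 0 0
   = 2 * (W^T *m M *m (imA rk *m W)) 0 0.
  by rewrite mulmxDr mulmxDl mxE bform_tr mulmxA !mulmxA mulr_natl mulr2n.
have Q2E : (W^T *m (Mstar M + (Mstar M)^T) *m W) 0 0 =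
    2 * (theta * (W^T *m M *m (exA rk *m G)) 0 0
         - sigma * (W^T *m M *m (imA rk *m W)) 0 0 + w ^+ 2 - W ord_max 0 ^+ 2).
  (* In M_* the part M J is evaluated through [JW], and the diagonal part contributes the square of
     the first stage minus that of the last. *)
  rewrite mulmxDr mulmxDl mxE bform_tr.
  suff -> : (W^T *m Mstar M *m W) 0 0 =
    theta * (W^T *m M *m (exA rk *m G)) 0 0
    - sigma * (W^T *m M *m (imA rk *m W)) 0 0 + (w ^+ 2 - W ord_max 0 ^+ 2).
    by lra.
  rewrite /Mstar mulmxDr mulmxDl mxE mulmxA -mulmxA JW; congr (_ + _).
    by rewrite bformDr -scaleNr !bformZr mulNr.
  rewrite -mulmxA mxE; under eq_bigr => j _ do rewrite mul_diag_mx !mxE.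
  under eq_bigr => j _ do rewrite mulrBl mulrBr.
  rewrite sumrB (bigD1 ord0) //= big1 ?addr0; last first.
    by move=> j /negbTE; rewrite -val_eqE => ->; rewrite mul0r mulr0.
  rewrite (bigD1 ord_max) //= [X in _ - (_ + X)]big1 ?addr0; last first.
    by move=> j /negbTE; rewrite -val_eqE => ->; rewrite mul0r mulr0.
  by rewrite eqxx !mul1r W0 !expr2.
rewrite Q1E in Q1; rewrite Q2E.
have : 0 <= sigma * (W^T *m M *m (imA rk *m W)) 0 0 by rewrite mulr_ge0 //; lra.
by lra.
Qed.

(** The constant part of W is evaluated by the column sums of M. At leading order only the last row
    sum of [exA] survives; every other term contains a deviation d or h. *)
Lemma exA_first_order rk M (W G d h : 'cV[R]_r.+2) (w g : R) : condM2 M ->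
  W = const_mx w + d -> G = const_mx g + h ->
  (W^T *m M *m (exA rk *m G)) 0 0 =
    2 * w * g * (exA rk *m ones) ord_max 0
    + (2 * w * (exA rk *m h) ord_max 0 + (d^T *m (M *m exA rk) *m G) 0 0).
Proof.
move=> cM2 -> eqG; rewrite bformDl addrA; congr (_ + _); last by rewrite !mulmxA.
have cst c : const_mx c = c *: ones by rewrite scalemx_const mulr1.
rewrite (cst w) bformZl condM2_first_order ?exA_row0 // eqG (cst g).
suff -> : (exA rk *m (g *: ones + h)) ord_max 0 =
  g * (exA rk *m ones) ord_max 0 + (exA rk *m h) ord_max 0 by ring.
by rewrite mulmxDr -scalemxAr [LHS]mxE [X in X + _]mxE.
Qed.

End Energy.

(** * Scalar inequalities for a single mode *)

Section ModeEstimate.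
Context {R : realType}.

(* At order theta the exchange of energy between u and w cancels: the factors of
   [u1 * w2 - u2 * w1] sum to zero. *)
Lemma first_order_cancel (beta b theta gam B c u1 u2 w1 w2 s1 s2 D1 D2
    xk1 xk2 yh1 yh2 z1 z2 : R) :
  let f1 := b * u1 + w1 in let f2 := b * u2 + w2 in
  let g1 := beta * u1 - b * w1 in let g2 := beta * u2 - b * w2 in
  let xF1 := B * f1 + xk1 in let xF2 := B * f2 + xk2 in
  let y1 := (B - c) * g1 + yh1 in let y2 := (B - c) * g2 + yh2 in
  s1 ^+ 2 <= w1 ^+ 2 - gam * D1 + theta * (2 * w1 * g2 * c + z1) ->
  s2 ^+ 2 <= w2 ^+ 2 - gam * D2 - theta * (2 * w2 * g1 * c + z2) ->
  beta * ((u1 + theta * xF2) ^+ 2 + (u2 - theta * xF1) ^+ 2)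
    + ((s1 + theta * y2) ^+ 2 + (s2 - theta * y1) ^+ 2) <=
  beta * (u1 ^+ 2 + u2 ^+ 2) + (w1 ^+ 2 + w2 ^+ 2) - gam * (D1 + D2)
    + (beta * (2 * theta * (u1 * xk2 - u2 * xk1)
               + theta ^+ 2 * (xF1 ^+ 2 + xF2 ^+ 2))
    + (theta * (z1 - z2) + 2 * theta * ((s1 - w1) * y2 - (s2 - w2) * y1)
    + 2 * theta * (w1 * yh2 - w2 * yh1) + theta ^+ 2 * (y1 ^+ 2 + y2 ^+ 2))).
Proof.
move=> f1 f2 g1 g2 xF1 xF2 y1 y2 h1 h2.
(* The slack of the conclusion is exactly the sum of the slacks of the two hypotheses. *)
rewrite -subr_ge0 in h1; rewrite -subr_ge0 in h2; rewrite -subr_ge0.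
apply: le_trans (addr_ge0 h1 h2) _; rewrite le_eqVlt; apply/orP; left; apply/eqP.
by rewrite /xF1 /xF2 /y1 /y2 /f1 /f2 /g1 /g2; ring.
Qed.

Lemma cross_bound (x1 x2 y1 y2 S c : R) :
  `|x1| + `|x2| <= S -> `|y1| <= c -> `|y2| <= c -> `|x1 * y2 - x2 * y1| <= S * c.
Proof.
move=> xS y1c y2c; apply: le_trans (ler_normB _ _) _; rewrite !normrM.
apply: (@le_trans _ _ (`|x1| * c + `|x2| * c)).
  by rewrite lerD // ler_wpM2l.
by rewrite -mulrDl ler_wpM2r // (le_trans _ y1c).
Qed.

Lemma sqr_bound (x a : R) : `|x| <= a -> x ^+ 2 <= a ^+ 2.
Proof. by move=> xa; rewrite -real_normK ?num_real // lerXn2r ?nnegrE ?(le_trans _ xa). Qed.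

(* Young's inequality; the damping [gam] absorbs the terms containing [del]. *)
Lemma absorb (gam y m del : R) : 0 < gam -> 0 <= y -> y <= 4^-1 ->
  y <= gam / 64 -> 0 <= m -> 0 <= del ->
  12 * y * del * (m + del) + 40 * y ^+ 2 * (m + del) ^+ 2 <=
  gam * del ^+ 2 + (72 / gam + 80) * y ^+ 2 * m ^+ 2.
Proof.
move=> gam0 y0 y4 yg m0 del0.
have h1 : 40 * y ^+ 2 * (m + del) ^+ 2 <= 80 * y ^+ 2 * (m ^+ 2 + del ^+ 2).
  have := sqr_ge0 (y * (m - del)); nra.
have h2 : 12 * y * del * m <= gam / 2 * del ^+ 2 + 72 / gam * y ^+ 2 * m ^+ 2.
  rewrite -subr_ge0.
  have -> : gam / 2 * del ^+ 2 + 72 / gam * y ^+ 2 * m ^+ 2 - 12 * y * del * m =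
      (2 * gam)^-1 * (gam * del - 12 * y * m) ^+ 2.
    by field; rewrite gt_eqF.
  by rewrite mulr_ge0 ?sqr_ge0 // invr_ge0 mulr_ge0 // ltW.
(* As y is at most 1/4, the coefficient on the left is at most 32 y, and the bound gam / 64 turns
   this into gam / 2. *)
have h3 : (12 * y + 80 * y ^+ 2) * del ^+ 2 <= gam / 2 * del ^+ 2.
  rewrite ler_wpM2r ?sqr_ge0 //.
  have : y ^+ 2 <= y / 4 by rewrite expr2; nra.
  by lra.
by lra.
Qed.

End ModeEstimate.

(** * Energy growth of one Fourier mode *)

Section ModeGrowth.
Context {R : realType} {r : nat}.

Local Notation ones := (const_mx 1 : 'cV[R]_r.+2).

Lemma mulmx_bound m (A : 'M[R]_(m, r.+2)) (x : 'cV[R]_r.+2) i (a c : R) :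
  l1norm A <= a -> l1norm x <= c -> `|(A *m x) i 0| <= a * c.
Proof.
move=> Aa xc; apply: le_trans (entry_le_l1norm _ _ _) _.
by apply: le_trans (l1normM _ _) _; rewrite ler_pM ?l1norm_ge0.
Qed.

Lemma bform_bound (Q : 'M[R]_r.+2) (x y : 'cV[R]_r.+2) (a c e : R) :
  l1norm x <= a -> l1norm Q <= c -> l1norm y <= e ->
  `|(x^T *m Q *m y) 0 0| <= a * c * e.
Proof.
move=> xa Qc ye; apply: mulmx_bound ye; apply: le_trans (l1normM _ _) _.
by rewrite l1norm_tr ler_pM ?l1norm_ge0.
Qed.

Lemma deviation_bound (b beta : R) (e d : 'cV[R]_r.+2) :
  `|b| <= 1 -> 0 <= beta <= 1 ->
  l1norm (b *: e + d) <= l1norm e + l1norm d /\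
  l1norm (beta *: e - b *: d) <= l1norm e + l1norm d.
Proof.
move=> b1 /andP[beta0 beta1]; have e0 := l1norm_ge0 e; have d0 := l1norm_ge0 d.
split; apply: le_trans (l1normD _ _) _; rewrite ?l1normN !l1normZ lerD ?ler_piMl //.
by rewrite ger0_norm.
Qed.

(* One Fourier mode, with [theta = k * dt] and [sigma = dt / eps]; [x1] and [x2]
   stand for the real and imaginary parts of [x]. *)
Definition mode_growth_bound (b : R) (rk : imex_rk R r.+2) (t0 K : R) : Prop :=
  forall (theta sigma u1 u2 w1 w2 : R) (U1 U2 W1 W2 : 'cV[R]_r.+2),
  0 <= sigma -> `|theta| <= t0 ->
  let F1 := b *: U1 + W1 in let F2 := b *: U2 + W2 in
  let G1 := (1 - b ^+ 2) *: U1 - b *: W1 in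
  let G2 := (1 - b ^+ 2) *: U2 - b *: W2 in
  U1 = const_mx u1 + theta *: (exA rk *m F2) ->
  U2 = const_mx u2 - theta *: (exA rk *m F1) ->
  W1 = const_mx w1 + theta *: (exA rk *m G2) - sigma *: (imA rk *m W1) ->
  W2 = const_mx w2 - theta *: (exA rk *m G1) - sigma *: (imA rk *m W2) ->
  (1 - b ^+ 2) * ((u1 + theta * (exb rk *m F2) 0 0) ^+ 2
          + (u2 - theta * (exb rk *m F1) 0 0) ^+ 2)
  + ((w1 + theta * (exb rk *m G2) 0 0 - sigma * (imb rk *m W1) 0 0) ^+ 2
     + (w2 - theta * (exb rk *m G1) 0 0 - sigma * (imb rk *m W2) 0 0) ^+ 2)
  <= (1 + K * theta ^+ 2) *
     ((1 - b ^+ 2) * (u1 ^+ 2 + u2 ^+ 2) + (w1 ^+ 2 + w2 ^+ 2)).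

Lemma mode_growth (b : R) (rk : imex_rk R r.+2) (M : 'M[R]_r.+2) :
  `|b| < 1 -> type_CK rk -> ISA rk -> condM1 rk M -> condM2 M ->
  exists t0 K : R, [/\ 0 < t0, 0 <= K &
    mode_growth_bound b rk t0 K].
Proof.
move=> hb hCK hISA cM1 cM2.
pose beta : R := 1 - b ^+ 2.
have b2 : b ^+ 2 < 1 by rewrite -real_normK ?num_real // expr_lt1.
have beta0 : 0 < beta by rewrite /beta; lra.
have beta1 : beta <= 1 by rewrite /beta; have := sqr_ge0 b; lra.
have [psdQ rkQ] := cM2.
have ones0 : ones != 0 by apply/eqP => /colP/(_ ord0)/eqP; rewrite !mxE oner_eq0.
have [K0 K0ge coer] :=
  psd_coercive psdQ ones0 (condM2_ones cM2) rkQ (@Jmx_ones _ r).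
(* Damping rate: coercivity with constant [K0], halved as the form is in [stage_energy]; the 1 keeps
   the denominator positive when [K0] is 0. *)
pose gam := (2 * (K0 + 1))^-1.
have gam0 : 0 < gam by rewrite invr_gt0; lra.
(* By ISA the updated w differs from the last w-stage only through the explicit weights [q]. *)
pose At := exA rk; pose bt := exb rk; pose q := bt - row ord_max At.
(* One majorant for all matrices involved, for the norm r + 2 of the constant vector, and for 1. *)
pose L : R := 1 + r.+2%:R + l1norm At + l1norm bt + l1norm q + l1norm (M *m At).
have [At0 bt0 q0 MAt0 n0] : [/\ 0 <= l1norm At, 0 <= l1norm bt, 0 <= l1norm q,
   0 <= l1norm (M *m At) & 0 <= r.+2%:R :> R] by rewrite !l1norm_ge0 ler0n.
have [LAt Lbt Lq LMAt] : [/\ l1norm At <= L, l1norm bt <= L, l1norm q <= L &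
   l1norm (M *m At) <= L] by move: At0 bt0 q0 MAt0 n0; rewrite /L; clear; split; lra.
have [L1 Ln] : 1 <= L /\ r.+2%:R <= L.
  by move: At0 bt0 q0 MAt0 n0; rewrite /L; clear; split; lra.
have L0 : 0 < L by apply: lt_le_trans L1.
(* Chosen so that y = |theta| L^2 meets the smallness conditions of [absorb] with damping gam / 2.
   In [K], the first factor comes from [absorb], L^4 from y^2, and 4 / beta from comparing m^2 with
   the energy. *)
pose t0 := Num.min 4^-1 (gam / 2 / 64) / L ^+ 2.
pose K := (72 / (gam / 2) + 80) * L ^+ 4 * (4 / beta).
have c72 : 0 <= 72 / (gam / 2) + 80.
  by rewrite addr_ge0 // ltW // divr_gt0 // divr_gt0.
have K00 : 0 <= K.
  rewrite /K; apply: mulr_ge0; last by rewrite ltW // divr_gt0.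
  by apply: mulr_ge0 => //; apply/exprn_ge0/ltW.
exists t0, K; split => //.
  by rewrite /t0 divr_gt0 ?exprn_gt0 // lt_min invr_gt0 ltr0n !divr_gt0.
move=> theta sigma u1 u2 w1 w2 U1 U2 W1 W2 sigma0 thetat0.
rewrite -/beta => F1 F2 G1 G2 eU1 eU2 eW1 eW2.
have W0 W w (G : 'cV[R]_r.+2) : W = const_mx w + theta *: (At *m G) - sigma *: (imA rk *m W) ->
    W ord0 0 = w.
  move=> ->; move: (exA_row0 rk G) (imA_row0 W hCK); rewrite !mxE => -> ->.
  by rewrite !mulr0 subr0 addr0.
(* The imaginary part obeys the same equation as the real part with -G1 in place of G2, so
   [stage_energy] applies to both. *)
have eW2' : W2 = const_mx w2 + theta *: (At *m - G1) - sigma *: (imA rk *m W2).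
  by rewrite mulmxN scalerN.
(* Deviations of the stages from the old values; k and h below are the induced deviations of the two
   fluxes. *)
pose e1 := U1 - const_mx u1; pose e2 := U2 - const_mx u2.
pose d1 := W1 - const_mx w1; pose d2 := W2 - const_mx w2.
have dJ1 : Jmx r *m W1 = d1 by rewrite Jmx_mulE (W0 _ _ _ eW1).
have dJ2 : Jmx r *m W2 = d2 by rewrite Jmx_mulE (W0 _ _ _ eW2').
have eqU1 : U1 = const_mx u1 + e1 by rewrite addrC subrK.
have eqU2 : U2 = const_mx u2 + e2 by rewrite addrC subrK.
have eqW1 : W1 = const_mx w1 + d1 by rewrite addrC subrK.
have eqW2 : W2 = const_mx w2 + d2 by rewrite addrC subrK.
pose f1 := b * u1 + w1; pose f2 := b * u2 + w2.
pose g1 := beta * u1 - b * w1; pose g2 := beta * u2 - b * w2.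
pose k1 := b *: e1 + d1; pose k2 := b *: e2 + d2.
pose h1 := beta *: e1 - b *: d1; pose h2 := beta *: e2 - b *: d2.
have eqF (u w : R) (e d : 'cV[R]_r.+2) :
    b *: (const_mx u + e) + (const_mx w + d) = const_mx (b * u + w) + (b *: e + d).
  by apply/colP => i; rewrite !mxE; ring.
have eqG (u w : R) (e d : 'cV[R]_r.+2) :
    beta *: (const_mx u + e) - b *: (const_mx w + d) =
    const_mx (beta * u - b * w) + (beta *: e - b *: d).
  by apply/colP => i; rewrite !mxE; ring.
have eqF1 : F1 = const_mx f1 + k1 by rewrite /F1 {1}eqU1 {1}eqW1 eqF.
have eqF2 : F2 = const_mx f2 + k2 by rewrite /F2 {1}eqU2 {1}eqW2 eqF.
have eqG1 : G1 = const_mx g1 + h1 by rewrite /G1 {1}eqU1 {1}eqW1 eqG.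
have eqG2 : G2 = const_mx g2 + h2 by rewrite /G2 {1}eqU2 {1}eqW2 eqG.
pose m : R := `|u1| + `|u2| + `|w1| + `|w2|.
pose D := l1norm e1 + l1norm e2; pose del := l1norm d1 + l1norm d2.
pose S : R := m + del; pose t : R := `|theta|; pose y : R := t * L ^+ 2.
have [le1 le2 ld1 ld2] : [/\ 0 <= l1norm e1, 0 <= l1norm e2, 0 <= l1norm d1 &
   0 <= l1norm d2] by rewrite !l1norm_ge0.
have [ab1 ab2 ab3 ab4] : [/\ 0 <= `|u1|, 0 <= `|u2|, 0 <= `|w1| & 0 <= `|w2|] by [].
have m0 : 0 <= m by rewrite !addr_ge0.
have del0 : 0 <= del by rewrite addr_ge0.
have D0 : 0 <= D by rewrite addr_ge0.
have t_ge0 : 0 <= t by rewrite /t.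
have y0 : 0 <= y by rewrite /y mulr_ge0 // exprn_ge0 // ltW.
have [y4 yg] : y <= 4^-1 /\ y <= gam / 2 / 64.
  have : y <= Num.min 4^-1 (gam / 2 / 64).
    by rewrite /y -ler_pdivlMr ?exprn_gt0.
  by rewrite le_min => /andP.
have b1 : `|b| <= 1 by apply: ltW.
have absfg (u w : R) : `|b * u + w| <= `|u| + `|w| /\ `|beta * u - b * w| <= `|u| + `|w|.
  split; [apply: le_trans (ler_normD _ _) _ | apply: le_trans (ler_normB _ _) _];
  rewrite !normrM lerD ?ler_piMl //.
  by rewrite ger0_norm // ltW.
have [af1 ag1] := absfg u1 w1; have [af2 ag2] := absfg u2 w2.
have betaI : 0 <= beta <= 1 by rewrite beta1 ltW.
have [lk1 lh1] := deviation_bound e1 d1 b1 betaI.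
have [lk2 lh2] := deviation_bound e2 d2 b1 betaI.
have cstL c (f : R) : `|f| <= c -> l1norm (const_mx f : 'cV[R]_r.+2) <= L * c.
  by move=> fc; rewrite l1norm_const ler_pM.
have lF1 : l1norm F1 <= L * (`|u1| + `|w1|) + (l1norm e1 + l1norm d1).
  by rewrite eqF1; apply: le_trans (l1normD _ _) _; rewrite lerD // cstL.
have lF2 : l1norm F2 <= L * (`|u2| + `|w2|) + (l1norm e2 + l1norm d2).
  by rewrite eqF2; apply: le_trans (l1normD _ _) _; rewrite lerD // cstL.
have lG1 : l1norm G1 <= L * (`|u1| + `|w1|) + (l1norm e1 + l1norm d1).
  by rewrite eqG1; apply: le_trans (l1normD _ _) _; rewrite lerD // cstL.
have lG2 : l1norm G2 <= L * (`|u2| + `|w2|) + (l1norm e2 + l1norm d2).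
  by rewrite eqG2; apply: le_trans (l1normD _ _) _; rewrite lerD // cstL.
(* The u-stages carry no stiff term, so their deviation satisfies D <= y (S + D), which is solved
   for D since y is small. The deviation [del] of the w-stages has no such bound, [sigma] being
   arbitrary; it is left to the damping. *)
have D2 : D <= 2 * y * S.
  have De1 : l1norm e1 <= t * (L * l1norm F2).
    rewrite /e1 eU1 addrAC subrr add0r l1normZ ler_wpM2l //.
    by apply: le_trans (l1normM _ _) _; rewrite ler_wpM2r ?l1norm_ge0.
  have De2 : l1norm e2 <= t * (L * l1norm F1).
    rewrite /e2 eU2 addrAC subrr add0r l1normN l1normZ ler_wpM2l //.
    by apply: le_trans (l1normM _ _) _; rewrite ler_wpM2r ?l1norm_ge0.
  have DF : l1norm F1 + l1norm F2 <= L * (S + D).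
    apply: (@le_trans _ _ (L * m + 1 * (D + del))).
      by move: lF1 lF2; rewrite /m /D /del; clear; lra.
    rewrite /S [leRHS](_ : _ = L * m + L * (D + del)); last by ring.
    by rewrite lerD2l ler_wpM2r // addr_ge0.
  have : D <= y * (S + D).
    apply: (@le_trans _ _ (t * (L * (l1norm F1 + l1norm F2)))).
      by move: De1 De2; rewrite /D; clear; lra.
    rewrite [leRHS](_ : _ = t * (L * (L * (S + D)))); last by rewrite /y; ring.
    by rewrite !ler_wpM2l // ltW.
  have : y * D <= D / 2.
    rewrite mulrC ler_wpM2l //; apply: le_trans y4 _.
    by rewrite lef_pV2 ?posrE ?ltr0n // ler_nat.
  by clear; lra.
have S0 : 0 <= S by rewrite addr_ge0.
have DS : D <= S.
  by apply: le_trans D2 _; rewrite ler_piMl //; move: y4; clear; lra.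
have big_le (a c : R) : 0 <= a -> a <= m -> 0 <= c -> c <= D + del ->
    L * a + c <= 2 * L * S.
  move=> a0 am c0 cdel.
  have LD : 1 * D <= L * S by rewrite ler_pM.
  have Ldel : 1 * del <= L * del by rewrite ler_wpM2r.
  have Lam : L * a <= L * m by rewrite ler_wpM2l // ltW.
  by move: cdel LD Ldel Lam; rewrite /S; clear; lra.
have [m1 m2] : `|u1| + `|w1| <= m /\ `|u2| + `|w2| <= m.
  by move: ab1 ab2 ab3 ab4; rewrite /m; clear; split; lra.
have [dd1 dd2] : l1norm e1 + l1norm d1 <= D + del /\
    l1norm e2 + l1norm d2 <= D + del.
  by move: le1 le2 ld1 ld2; rewrite /D /del; clear; split; lra.
have {}lF1 : l1norm F1 <= 2 * L * S by rewrite (le_trans lF1) // big_le ?addr_ge0.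
have {}lF2 : l1norm F2 <= 2 * L * S by rewrite (le_trans lF2) // big_le ?addr_ge0.
have {}lG1 : l1norm G1 <= 2 * L * S by rewrite (le_trans lG1) // big_le ?addr_ge0.
have {}lG2 : l1norm G2 <= 2 * L * S by rewrite (le_trans lG2) // big_le ?addr_ge0.
pose eta : R := 2 * y * S + del.
have eta0 : 0 <= eta by rewrite addr_ge0 // mulr_ge0 // mulr_ge0.
have {}lk1 : l1norm k1 <= eta.
  by apply: le_trans lk1 _; apply: le_trans dd1 _; rewrite lerD2r.
have {}lk2 : l1norm k2 <= eta.
  by apply: le_trans lk2 _; apply: le_trans dd2 _; rewrite lerD2r.
have {}lh1 : l1norm h1 <= eta.
  by apply: le_trans lh1 _; apply: le_trans dd1 _; rewrite lerD2r.
have {}lh2 : l1norm h2 <= eta.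
  by apply: le_trans lh2 _; apply: le_trans dd2 _; rewrite lerD2r.
(* Coercivity of the (M2) form controls J W, that is, the deviation of the w-stages. *)
have damp (W : 'cV[R]_r.+2) : gam * l1norm (Jmx r *m W) ^+ 2 <=
    (W^T *m (Mstar M + (Mstar M)^T) *m W) 0 0 / 2.
  have [_ pos] := psdQ; have := pos W; have := coer W.
  set X := (_ *m W) 0 0 => cW X0.
  have K1 : 0 < 2 * (K0 + 1) by rewrite mulr_gt0 // ltr_wpDl.
  rewrite /gam mulrC ler_pdivrMr //.
  by move: cW X0; clear; lra.
pose c : R := (At *m ones) ord_max 0.
have cE : c = (At *m ones) ord_max 0 by [].
pose B := (bt *m ones) 0 0.
have mul_cst p (P : 'M[R]_(p, r.+2)) (g : R) (h : 'cV[R]_r.+2) i :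
    (P *m (const_mx g + h)) i 0 = (P *m ones) i 0 * g + (P *m h) i 0.
  have -> : const_mx g = g *: ones by rewrite scalemx_const mulr1.
  by rewrite mulmxDr -scalemxAr [LHS]mxE [X in X + _]mxE mulrC.
have qones : (q *m ones) 0 0 = B - c.
  by rewrite mulmxBl -row_mul [LHS]mxE [X in _ + X]mxE [X in _ - X]mxE cE.
have lin (a x z : R) (P Q : 'cV[R]_r.+2) :
    (const_mx a + x *: P - z *: Q) ord_max 0 = a + x * P ord_max 0 - z * Q ord_max 0.
  by rewrite !mxE.
(* ISA: the stiff term of the last stage is the stiff term of the update. *)
have bE (W : 'cV[R]_r.+2) : (imA rk *m W) ord_max 0 = (imb rk *m W) 0 0.
  by rewrite !mxE; apply: eq_bigr => j _; rewrite hISA.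
have s1E : W1 ord_max 0 = w1 + theta * (At *m G2) ord_max 0 - sigma * (imb rk *m W1) 0 0.
  by rewrite {1}eW1 lin bE.
have s2E : W2 ord_max 0 = w2 - theta * (At *m G1) ord_max 0 - sigma * (imb rk *m W2) 0 0.
  by rewrite {1}eW2' lin bE mulmxN [in X in theta * X]mxE mulrN.
have qE (G : 'cV[R]_r.+2) : (q *m G) 0 0 = (bt *m G) 0 0 - (At *m G) ord_max 0.
  by rewrite mulmxBl -row_mul [LHS]mxE [X in _ + X]mxE [X in _ - X]mxE.
pose z1 := 2 * w1 * (At *m h2) ord_max 0 + (d1^T *m (M *m At) *m G2) 0 0.
pose z2 := 2 * w2 * (At *m h1) ord_max 0 + (d2^T *m (M *m At) *m G1) 0 0.
have E1 := exA_first_order rk cM2 eqW1 eqG2.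
have E2 := exA_first_order rk cM2 eqW2 eqG1.
rewrite -/At -cE -/z1 in E1; rewrite -/At -cE -/z2 in E2.
have st1 := stage_energy hCK cM1 sigma0 eW1.
have st2 := stage_energy hCK cM1 sigma0 eW2'.
rewrite -/At E1 in st1.
rewrite -/At mulmxN mulmxN [in X in theta * X]mxE E2 mulrN in st2.
have hs1 : W1 ord_max 0 ^+ 2 <=
    w1 ^+ 2 - gam * l1norm d1 ^+ 2 + theta * (2 * w1 * g2 * c + z1).
  by apply: le_trans st1 _; have := damp W1; rewrite dJ1; clear; lra.
have hs2 : W2 ord_max 0 ^+ 2 <=
    w2 ^+ 2 - gam * l1norm d2 ^+ 2 - theta * (2 * w2 * g1 * c + z2).
  by apply: le_trans st2 _; have := damp W2; rewrite dJ2; clear; lra.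
(* On constants [q] takes the value B - c, the coefficient for which the first-order terms
   cancel. *)
have := first_order_cancel B ((bt *m k1) 0 0) ((bt *m k2) 0 0)
  ((q *m h1) 0 0) ((q *m h2) 0 0) hs1 hs2.
rewrite -/f1 -/f2 -/g1 -/g2 -qones -!mul_cst -eqF1 -eqF2 -eqG1 -eqG2.
have -> : w1 + theta * (bt *m G2) 0 0 - sigma * (imb rk *m W1) 0 0 =
    W1 ord_max 0 + theta * (q *m G2) 0 0 by rewrite qE s1E; ring.
have -> : w2 - theta * (bt *m G1) 0 0 - sigma * (imb rk *m W2) 0 0 =
    W2 ord_max 0 - theta * (q *m G1) 0 0 by rewrite qE s2E; ring.
move=> main; apply: le_trans main _.
have thetaB (x a : R) : `|x| <= a -> theta * x <= t * a.
  by move=> xa; apply: le_trans (ler_norm _) _; rewrite normrM ler_wpM2l.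
have [uS wS] : `|u1| + `|u2| <= S /\ `|w1| + `|w2| <= S.
  by move: ab1 ab2 ab3 ab4 del0; rewrite /S /m; clear; split; lra.
have FB (P : 'M[R]_(1, r.+2)) (x : 'cV[R]_r.+2) :
    l1norm P <= L -> l1norm x <= 2 * L * S -> `|(P *m x) 0 0| <= 2 * L ^+ 2 * S.
  move=> PL xS; rewrite [leRHS](_ : _ = L * (2 * L * S)); last by ring.
  exact: mulmx_bound.
(* The surviving terms linear in theta all contain a deviation: those of the fluxes are bounded by
   [eta], those of the w-stages by [del]. *)
have r1 : theta * (u1 * (bt *m k2) 0 0 - u2 * (bt *m k1) 0 0) <= t * (S * (L * eta)).
  by apply: thetaB; apply: cross_bound; rewrite ?mulmx_bound.
have r2 : theta * (w1 * (q *m h2) 0 0 - w2 * (q *m h1) 0 0) <= t * (S * (L * eta)).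
  by apply: thetaB; apply: cross_bound; rewrite ?mulmx_bound.
have r3 : theta * (w1 * (At *m h2) ord_max 0 - w2 * (At *m h1) ord_max 0)
    <= t * (S * (L * eta)).
  by apply: thetaB; apply: cross_bound; rewrite ?mulmx_bound.
have r4 : theta * ((d1^T *m (M *m At) *m G2) 0 0 - (d2^T *m (M *m At) *m G1) 0 0)
    <= t * (del * (2 * L ^+ 2 * S)).
  apply: thetaB; apply: le_trans (ler_normB _ _) _.
  rewrite [leRHS](_ : _ = l1norm d1 * L * (2 * L * S) + l1norm d2 * L * (2 * L * S)).
    by rewrite lerD // bform_bound.
  by rewrite /del; ring.
have r5 : theta * ((W1 ord_max 0 - w1) * (q *m G2) 0 0
    - (W2 ord_max 0 - w2) * (q *m G1) 0 0) <= t * (del * (2 * L ^+ 2 * S)).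
  apply: thetaB; apply: cross_bound; rewrite ?FB // /del lerD //.
    by have := entry_le_l1norm d1 ord_max 0; rewrite mxE [X in _ + X]mxE mxE.
  by have := entry_le_l1norm d2 ord_max 0; rewrite mxE [X in _ + X]mxE mxE.
have sq (P : 'M[R]_(1, r.+2)) (x : 'cV[R]_r.+2) :
    l1norm P <= L -> l1norm x <= 2 * L * S ->
    theta ^+ 2 * (P *m x) 0 0 ^+ 2 <= 4 * y ^+ 2 * S ^+ 2.
  move=> PL xS; rewrite [leRHS](_ : _ = theta ^+ 2 * (2 * L ^+ 2 * S) ^+ 2).
    by rewrite ler_wpM2l ?sqr_ge0 // sqr_bound // FB.
  by rewrite /y -(real_normK (num_real theta)) -/t; ring.
have [q1 q2] := (sq _ _ Lbt lF1, sq _ _ Lbt lF2).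
have [q3 q4] := (sq _ _ Lq lG1, sq _ _ Lq lG2).
have tL : t * (S * (L * eta)) <= y * S * (2 * y * S + del).
  rewrite -/eta /y [leLHS](_ : _ = (t * S * eta) * L); last by ring.
  rewrite [leRHS](_ : _ = (t * S * eta) * (L * L)); last by ring.
  by rewrite ler_wpM2l ?mulr_ge0 // ler_peMl // ltW.
have r6 : t * (del * (2 * L ^+ 2 * S)) = 2 * y * del * S by rewrite /y; ring.
have err1 : beta * (2 * theta * (u1 * (bt *m k2) 0 0 - u2 * (bt *m k1) 0 0) +
     theta ^+ 2 * ((bt *m F1) 0 0 ^+ 2 + (bt *m F2) 0 0 ^+ 2)) <=
     2 * (y * S * (2 * y * S + del)) + 8 * y ^+ 2 * S ^+ 2.
  set X := 2 * theta * _ + _.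
  have XB : X <= 2 * (y * S * (2 * y * S + del)) + 8 * y ^+ 2 * S ^+ 2.
    by move: r1 tL q1 q2; rewrite /X; clear; lra.
  apply: le_trans (ler_wpM2l (ltW beta0) XB) _; rewrite ler_piMl //.
  apply: addr_ge0; last by rewrite mulr_ge0 ?sqr_ge0 // mulr_ge0 ?sqr_ge0.
  by apply: mulr_ge0 => //; apply: mulr_ge0 => //; apply: mulr_ge0.
have err2 : theta * (z1 - z2) + 2 * theta * ((W1 ord_max 0 - w1) * (q *m G2) 0 0
     - (W2 ord_max 0 - w2) * (q *m G1) 0 0) +
   2 * theta * (w1 * (q *m h2) 0 0 - w2 * (q *m h1) 0 0) +
   theta ^+ 2 * ((q *m G1) 0 0 ^+ 2 + (q *m G2) 0 0 ^+ 2) <=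
   4 * (y * S * (2 * y * S + del)) + 6 * y * del * S + 8 * y ^+ 2 * S ^+ 2.
  by move: r2 r3 r4 r5 r6 tL q3 q4; rewrite /z1 /z2; clear; lra.
set Eold := beta * (u1 ^+ 2 + u2 ^+ 2) + (w1 ^+ 2 + w2 ^+ 2).
(* Four squares give the factor 4; dividing by beta makes up for the weight beta <= 1 on the
   u-part. *)
have msq : m ^+ 2 <= 4 / beta * Eold.
  rewrite mulrAC ler_pdivlMr //.
  have : m ^+ 2 <= 4 * ((u1 ^+ 2 + u2 ^+ 2) + (w1 ^+ 2 + w2 ^+ 2)).
    rewrite -(real_normK (num_real u1)) -(real_normK (num_real u2)).
    rewrite -(real_normK (num_real w1)) -(real_normK (num_real w2)) /m.
    have := sqr_ge0 (`|u1| - `|u2|); have := sqr_ge0 (`|u1| - `|w1|).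
    have := sqr_ge0 (`|u1| - `|w2|); have := sqr_ge0 (`|u2| - `|w1|).
    have := sqr_ge0 (`|u2| - `|w2|); have := sqr_ge0 (`|w1| - `|w2|).
    by clear; lra.
  have : beta * (w1 ^+ 2 + w2 ^+ 2) <= w1 ^+ 2 + w2 ^+ 2.
    by rewrite ler_piMl // addr_ge0 ?sqr_ge0.
  move=> hw hm; apply: (@le_trans _ _ (beta * (4 * ((u1 ^+ 2 + u2 ^+ 2) + (w1 ^+ 2 + w2 ^+ 2))))).
    by rewrite mulrC ler_wpM2l // ltW.
  by move: hw; rewrite /Eold; clear; lra.
(* The square of a sum of two is at most twice the sum of squares, which costs half of the
   damping. *)
have young : gam / 2 * del ^+ 2 <= gam * (l1norm d1 ^+ 2 + l1norm d2 ^+ 2).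
  rewrite -mulrA ler_pM2l // /del.
  by have := sqr_ge0 (l1norm d1 - l1norm d2); clear; lra.
have gam20 : 0 < gam / 2 by rewrite divr_gt0.
have := absorb gam20 y0 y4 yg m0 del0; rewrite -/S => ab.
have KE : (72 / (gam / 2) + 80) * y ^+ 2 * m ^+ 2 <= K * theta ^+ 2 * Eold.
  rewrite [leRHS](_ : _ = (72 / (gam / 2) + 80) * y ^+ 2 * (4 / beta * Eold)).
    by rewrite ler_wpM2l // mulr_ge0 ?sqr_ge0.
  by rewrite /K /y -(real_normK (num_real theta)) -/t; ring.
(* [err1] and [err2] add up to 12 y del S + 28 y^2 S^2. [absorb] allows 40 in place of 28, so the
   nonnegativity of y^2 S^2 closes the gap. *)
by have := mulr_ge0 (sqr_ge0 y) (sqr_ge0 S); move: err1 err2 young ab KE; clear; lra.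
Qed.
End ModeGrowth.

(** * Trigonometric polynomials *)

Section Calculus.
Context {R : realType}.

Lemma is_derive_bigsum n (h : 'I_n -> R -> R) (dh : 'I_n -> R) (x : R) :
  (forall i, is_derive x 1 (h i) (dh i)) ->
  is_derive x 1 (fun y => \sum_(i < n) h i y) (\sum_(i < n) dh i).
Proof.
move=> dhi; have -> : (fun y => \sum_(i < n) h i y) = \sum_(i < n) h i.
  by apply/funext => y; rewrite fct_sumE.
exact: is_derive_sum.
Qed.

Lemma is_derive_mull (a x : R) : is_derive x 1 (fun y => a * y) a.
Proof.
apply: (is_derive_eq (is_deriveZ a (is_derive_id x (1 : R)))).
exact: mulr1.
Qed.

Lemma is_derive_cosM (a x : R) :
  is_derive x 1 (fun y => cos (a * y)) (- (a * sin (a * x))).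
Proof.
apply: (is_derive_eq (is_derive1_comp (is_derive_cos _) (is_derive_mull a x))).
by rewrite mulNr mulrC.
Qed.

Lemma is_derive_sinM (a x : R) :
  is_derive x 1 (fun y => sin (a * y)) (a * cos (a * x)).
Proof.
apply: (is_derive_eq (is_derive1_comp (is_derive_sin _) (is_derive_mull a x))).
exact: mulrC.
Qed.

Lemma is_derive_continuous (F f : R -> R) :
  (forall x : R, is_derive x 1 F (f x)) -> continuous F.
Proof.
move=> dF x; apply: differentiable_continuous; apply/derivable1_diffP.
exact: ex_derive.
Qed.

Lemma integral_derive (F f : R -> R) (a b : R) : a < b ->
  (forall x : R, is_derive x 1 F (f x)) -> continuous f ->
  (\int[@lebesgue_measure R]_(x in `[a, b]) (f x)%:E = (F b - F a)%:E)%E.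
Proof.
move=> ab dF cf; rewrite (continuous_FTC2 ab (F := F)) ?EFinB //.
- exact: continuous_subspaceT.
- have cF := is_derive_continuous dF.
  split; first by move=> x _; apply: ex_derive.
  + by apply: cvg_at_right_filter; apply: cF.
  + by apply: cvg_at_left_filter; apply: cF.
- by move=> x _; rewrite derive1E; apply: derive_val.
Qed.

End Calculus.

(** * Fourier modes and Parseval's identity *)

Section TrigPolynomials.
Context {R : realType}.
Implicit Types (z : R[i]) (k : int) (x : R).

Lemma ReD (z1 z2 : R[i]) : complex.Re (z1 + z2) = complex.Re z1 + complex.Re z2.
Proof. by case: z1; case: z2. Qed.

Lemma ImD (z1 z2 : R[i]) : complex.Im (z1 + z2) = complex.Im z1 + complex.Im z2.
Proof. by case: z1; case: z2. Qed.

Lemma Re_sum (I : Type) (s : seq I) (P : pred I) (F : I -> R[i]) :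
  complex.Re (\sum_(i <- s | P i) F i) = \sum_(i <- s | P i) complex.Re (F i).
Proof. exact: (big_morph (@complex.Re R) ReD). Qed.

Lemma Im_sum (I : Type) (s : seq I) (P : pred I) (F : I -> R[i]) :
  complex.Im (\sum_(i <- s | P i) F i) = \sum_(i <- s | P i) complex.Im (F i).
Proof. exact: (big_morph (@complex.Im R) ImD). Qed.

Lemma normc_sqr z :
  ComplexField.Normc.normc z ^+ 2 = complex.Re z ^+ 2 + complex.Im z ^+ 2.
Proof. by case: z => a b /=; rewrite sqr_sqrtr // addr_ge0 ?sqr_ge0. Qed.

Lemma cos_2pi_int k : cos (k%:~R * (2 * pi)) = 1 :> R.
Proof.
have nat_case (n : nat) : cos (n%:R * (2 * pi)) = 1 :> R.
  have -> : n%:R * (2 * pi) = 0 + pi *+ 2 *+ n :> R by rewrite add0r !mulr_natl.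
  by rewrite (periodicn (@cosD2pi R)) cos0.
case: k => n; first exact: nat_case.
by rewrite NegzE mulrNz mulNr cosN; apply: nat_case.
Qed.

Lemma sin_2pi_int k : sin (k%:~R * (2 * pi)) = 0 :> R.
Proof.
have nat_case (n : nat) : sin (n%:R * (2 * pi)) = 0 :> R.
  have -> : n%:R * (2 * pi) = 0 + pi *+ 2 *+ n :> R by rewrite add0r !mulr_natl.
  by rewrite (periodicn (@sinD2pi R)) sin0.
case: k => n; first exact: nat_case.
by rewrite NegzE mulrNz mulNr sinN; apply/eqP; rewrite oppr_eq0; apply/eqP/nat_case.
Qed.

Lemma is_derive_Re_expix z k x :
  is_derive x 1 (fun y => complex.Re (z * expix k y))
    (complex.Re (z * (0 +i* k%:~R) * expix k x)).
Proof.
case: z => a b.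
have -> : (fun y => complex.Re ((a +i* b) * expix k y)) =
  (a \*: (fun y => cos (k%:~R * y))) - (b \*: (fun y => sin (k%:~R * y))) :> (R -> R).
  by apply/funext => y.
apply: (is_derive_eq (is_deriveB (is_deriveZ a (is_derive_cosM _ _))
  (is_deriveZ b (is_derive_sinM _ _)))).
by rewrite /= /GRing.scale /=; ring.
Qed.

Lemma is_derive_Im_expix z k x :
  is_derive x 1 (fun y => complex.Im (z * expix k y))
    (complex.Im (z * (0 +i* k%:~R) * expix k x)).
Proof.
case: z => a b.
have -> : (fun y => complex.Im ((a +i* b) * expix k y)) =
  (a \*: (fun y => sin (k%:~R * y))) + (b \*: (fun y => cos (k%:~R * y))) :> (R -> R).
  by apply/funext => y.
apply: (is_derive_eq (is_deriveD (is_deriveZ a (is_derive_sinM _ _))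
  (is_deriveZ b (is_derive_cosM _ _)))).
by rewrite /= /GRing.scale /=; ring.
Qed.

Lemma expix_mul_conj k l x : expix k x * (expix l x)^* = expix (k - l) x.
Proof.
rewrite /expix; simpc; rewrite intrB mulrBl cosB sinB.
by congr (_ +i* _); ring.
Qed.

Definition wave N (j : 'I_N.*2.+1) : int := j%:Z - N%:Z.

(** Coefficients are indexed by the 2N + 1 modes alone, whereas [in_PN] takes them on all integers;
    this way the function determines them ([trig_inj]). *)
Definition trig N (c : 'I_N.*2.+1 -> R[i]) : R -> R[i] :=
  fun x => \sum_j c j * expix (wave j) x.

Lemma in_PN_trig N (f : R -> R[i]) : in_PN N f -> exists c, f = trig (N := N) c.
Proof. by case=> c cf; exists (fun j => c (wave j)); apply/funext. Qed.

Lemma wave_inj N : injective (@wave N).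
Proof. by move=> j l /addIr[] /val_inj. Qed.

Lemma is_derive_Re_trig N (c : 'I_N.*2.+1 -> R[i]) x :
  is_derive x 1 (fun y => complex.Re (trig c y))
    (complex.Re (trig (fun j => c j * (0 +i* (wave j)%:~R)) x)).
Proof.
rewrite Re_sum; under eq_fun do rewrite Re_sum.
by apply: is_derive_bigsum => j; apply: is_derive_Re_expix.
Qed.

Lemma is_derive_Im_trig N (c : 'I_N.*2.+1 -> R[i]) x :
  is_derive x 1 (fun y => complex.Im (trig c y))
    (complex.Im (trig (fun j => c j * (0 +i* (wave j)%:~R)) x)).
Proof.
rewrite Im_sum; under eq_fun do rewrite Im_sum.
by apply: is_derive_bigsum => j; apply: is_derive_Im_expix.
Qed.

Lemma dx_trig N (c : 'I_N.*2.+1 -> R[i]) :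
  dx (trig c) = trig (fun j => c j * (0 +i* (wave j)%:~R)).
Proof.
apply/funext => x; apply/eqP; rewrite eq_complex /= !derive1E; apply/andP; split.
  by have [_ ->] := is_derive_Re_trig c x.
by have [_ ->] := is_derive_Im_trig c x.
Qed.

(* The quotient is [0] at [k = 0], where the antiderivative is linear. *)
Definition expix_prim z k (x : R) : R :=
  if k == 0 then complex.Re z * x
  else complex.Im (z * expix k x) / k%:~R.

Lemma is_derive_expix_prim z k x :
  is_derive x 1 (expix_prim z k) (complex.Re (z * expix k x)).
Proof.
rewrite /expix_prim; case: eqVneq => [->|k0].
  have -> : complex.Re (z * expix 0 x) = complex.Re z.
    by case: z => a b; rewrite /= mul0r cos0 sin0 mulr1 mulr0 subr0.
  exact: is_derive_mull.
have := is_derive_Im_expix z k x => dI.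
have -> : (fun y => complex.Im (z * expix k y) / k%:~R) =
  ((k%:~R)^-1 \*: (fun y => complex.Im (z * expix k y))) :> (R -> R).
  by apply/funext => y; apply: mulrC.
apply: (is_derive_eq (is_deriveZ _ dI)).
have k0' : k%:~R != 0 :> R by rewrite intr_eq0.
by rewrite /GRing.scale /=; case: z {dI} => a b /=; field.
Qed.

Lemma expix_prim_period z k :
  expix_prim z k (2 * pi) - expix_prim z k 0 =
  if k == 0 then 2 * pi * complex.Re z else 0.
Proof.
rewrite /expix_prim; case: eqVneq => _; first by rewrite mulr0 subr0 mulrC.
by case: z => a b; rewrite /= cos_2pi_int sin_2pi_int !mulr0 cos0 sin0 !mulr0 subrr.
Qed.

Lemma trig_sqr N (c : 'I_N.*2.+1 -> R[i]) x :
  ComplexField.Normc.normc (trig c x) ^+ 2 =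
  \sum_j \sum_l complex.Re (c j * (c l)^* * expix (wave j - wave l) x).
Proof.
rewrite normc_sqr; transitivity (complex.Re (trig c x * (trig c x)^*)).
  by case: (trig c x) => a b /=; ring.
rewrite /trig rmorph_sum mulr_suml Re_sum; apply: eq_bigr => j _.
rewrite mulr_sumr Re_sum; apply: eq_bigr => l _.
by rewrite rmorphM mulrACA expix_mul_conj.
Qed.

Lemma continuous_Re_trig N (c : 'I_N.*2.+1 -> R[i]) :
  continuous (fun x => complex.Re (trig c x)).
Proof. exact: is_derive_continuous (is_derive_Re_trig c). Qed.

Lemma continuous_Im_trig N (c : 'I_N.*2.+1 -> R[i]) :
  continuous (fun x => complex.Im (trig c x)).
Proof. exact: is_derive_continuous (is_derive_Im_trig c). Qed.

Lemma continuous_trig_sqr N (c : 'I_N.*2.+1 -> R[i]) :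
  continuous (fun x => ComplexField.Normc.normc (trig c x) ^+ 2).
Proof.
under eq_fun do rewrite normc_sqr !expr2.
move=> x; apply: cvgD; apply: cvgM; do ?exact: continuous_Re_trig;
  exact: continuous_Im_trig.
Qed.

(** The squared modulus is a double sum with an explicit antiderivative. Over one period only the
    terms of equal wave numbers contribute, that is, the diagonal. *)
Lemma parseval N (c : 'I_N.*2.+1 -> R[i]) :
  (\int[@lebesgue_measure R]_(x in period_itv)
     (ComplexField.Normc.normc (trig c x) ^+ 2)%:E =
   (2 * pi * \sum_j ComplexField.Normc.normc (c j) ^+ 2)%:E)%E.
Proof.
pose F (x : R) := \sum_j \sum_l expix_prim (c j * (c l)^*) (wave j - wave l) x.
have dF (x : R) : is_derive x 1 F (ComplexField.Normc.normc (trig c x) ^+ 2).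
  rewrite trig_sqr; apply: is_derive_bigsum => j.
  by apply: is_derive_bigsum => l; apply: is_derive_expix_prim.
have pi2 : 0 < 2 * pi :> R by rewrite mulr_gt0 // pi_gt0.
rewrite (integral_derive pi2 dF (@continuous_trig_sqr _ c)).
congr (_%:E); rewrite -sumrB mulr_sumr; apply: eq_bigr => j _.
rewrite -sumrB; under eq_bigr do rewrite expix_prim_period subr_eq0.
rewrite (bigD1 j) //= eqxx big1 ?addr0; last first.
  by move=> l lj; rewrite (inj_eq (@wave_inj N)) eq_sym (negbTE lj).
by congr (_ * _); rewrite normc_sqr; case: (c j) => a b /=; ring.
Qed.

Lemma trigD N (c d : 'I_N.*2.+1 -> R[i]) x :
  trig c x + trig d x = trig (fun j => c j + d j) x.
Proof. by rewrite -big_split; apply: eq_bigr => j _; rewrite mulrDl. Qed.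

Lemma trigB N (c d : 'I_N.*2.+1 -> R[i]) x :
  trig c x - trig d x = trig (fun j => c j - d j) x.
Proof. by rewrite -sumrB; apply: eq_bigr => j _; rewrite mulrBl. Qed.

Lemma trigZ N (c : 'I_N.*2.+1 -> R[i]) z x :
  z * trig c x = trig (fun j => z * c j) x.
Proof. by rewrite mulr_sumr; apply: eq_bigr => j _; rewrite mulrA. Qed.

Lemma trig_sum N (I : finType) (P : pred I) (c : I -> 'I_N.*2.+1 -> R[i]) x :
  \sum_(i | P i) trig (c i) x = trig (fun j => \sum_(i | P i) c i j) x.
Proof. by rewrite exchange_big; apply: eq_bigr => j _; rewrite mulr_suml. Qed.

(** Parseval applied to the difference: a vanishing sum of squared moduli. *)
Lemma trig_inj N (c d : 'I_N.*2.+1 -> R[i]) :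
  (forall x, trig c x = trig d x) -> forall j, c j = d j.
Proof.
move=> cd j; have := parseval (fun j => c j - d j).
under eq_integral do rewrite -trigB cd subrr ComplexField.Normc.normc0 expr0n.
rewrite integral0 => -[] /esym/eqP.
rewrite mulf_eq0 gt_eqF ?mulr_gt0 ?pi_gt0 //= psumr_eq0; last first.
  by move=> l _; rewrite sqr_ge0.
move=> /allP/(_ j); rewrite mem_index_enum => /(_ isT) /=.
by rewrite sqrf_eq0 => /eqP/ComplexField.Normc.eq0_normc/eqP; rewrite subr_eq0 => /eqP.
Qed.

End TrigPolynomials.

(** * Square-integrable data and the Fourier projection *)

Section Projection.
Context {R : realType}.
Local Notation mu := (@lebesgue_measure R).
Local Notation normc := ComplexField.Normc.normc.

Lemma poweR2 (x : \bar R) : (0 <= x)%E -> (x `^ 2 = x ^+ 2)%E.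
Proof.
case: x => [r||] // r0; last by rewrite poweRyr ?pnatr_eq0 // expe2 mulyy.
by rewrite poweR_EFin powR_mulrn ?EFin_expe.
Qed.

Lemma L2norm_sqr (f : R -> R[i]) :
  (L2norm f ^+ 2 = \int[mu]_(x in period_itv) (normc (f x) ^+ 2)%:E)%E.
Proof.
rewrite -poweR2 ?Lnorm_ge0 // poweR_Lnorm ?pnatr_eq0 // [RHS]integral_mkcond.
apply: eq_integral => x _; rewrite !patchE; case: ifP => _.
  by rewrite poweR2 ?abse_ge0 // abse_EFin -EFin_expe real_normK ?num_real.
by rewrite abse0 poweR0r ?pnatr_eq0.
Qed.

Lemma energy_trig (b : R) N (c d : 'I_N.*2.+1 -> R[i]) :
  energy b (trig c) (trig d) =
  (2 * pi * \sum_j ((1 - b ^+ 2) * normc (c j) ^+ 2 + normc (d j) ^+ 2))%:E.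
Proof.
rewrite /energy !L2norm_sqr !parseval -EFinM -EFinD big_split /= -mulr_sumr.
by congr EFin; ring.
Qed.

Lemma L2fun_sqr_integrable (u : R -> R) : L2fun u ->
  mu.-integrable period_itv (EFin \o (fun x => u x ^+ 2)).
Proof.
move=> /Lfun2_integrable_sqr iu.
have : mu.-integrable period_itv (EFin \o (fun x => (u \_ period_itv) x ^+ 2)).
  by apply: (integrableS _ _ _ iu) => //; apply: measurable_itv.
by apply: eq_integrable => [|x xI]; [apply: measurable_itv | rewrite /= patchE xI].
Qed.

Lemma L2fun_measurable (u : R -> R) : L2fun u -> measurable_fun period_itv u.
Proof.
rewrite /L2fun inE => /andP[/[!inE] mu_ _].
by apply/measurable_restrictT => //; apply: measurable_itv.
Qed.

Lemma continuous_integrable (f : R -> R) : continuous f ->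
  mu.-integrable period_itv (EFin \o f).
Proof.
move=> cf; apply: continuous_compact_integrable; first exact: segment_compact.
exact: continuous_subspaceT.
Qed.

Lemma normc_real (x : R) : normc x%:C ^+ 2 = x ^+ 2.
Proof. by rewrite normc_sqr /= expr0n addr0. Qed.

(* Test the orthogonality relation against the projection itself:
   |g|^2 integrates to Re (u g^* ), hence to at most (u^2 + |g|^2) / 2. *)
Lemma projPN_contraction N (u : R -> R) (g : R -> R[i]) :
  L2fun u -> is_projPN N (fun x => (u x)%:C) g ->
  exists2 c, g = trig (N := N) c & (L2norm g ^+ 2 <= L2norm (fun x => (u x)%:C) ^+ 2)%E.
Proof.
move=> L2u [gPN /(_ g gPN) orth]; have [c gE] := in_PN_trig gPN.
exists c => //; rewrite !L2norm_sqr.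
under [leRHS]eq_integral do rewrite normc_real.
have mI : measurable (@period_itv R) by apply: measurable_itv.
pose p x := complex.Re (g x); pose G x := normc (g x) ^+ 2.
have iu := L2fun_sqr_integrable L2u.
have cp : continuous p by rewrite /p gE; apply: continuous_Re_trig.
have iG : mu.-integrable period_itv (EFin \o G).
  by apply: continuous_integrable; rewrite /G gE; apply: continuous_trig_sqr.
(* The product is dominated by u^2 + p^2. *)
have iup : mu.-integrable period_itv (EFin \o (fun x => u x * p x)).
  have ip2 : mu.-integrable period_itv (EFin \o (fun x => p x ^+ 2)).
    apply: continuous_integrable => x.
    by under eq_fun do rewrite expr2; apply: cvgM; apply: cp.
  apply: (le_integrable _ _ _ (integrableD _ iu ip2)) => //.
    apply/measurable_EFinP; apply: measurable_funM; first exact: L2fun_measurable.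
    by apply: measurable_funTS; apply: continuous_measurable_fun.
  move=> x _ /=; rewrite lee_fin [leRHS]ger0_norm ?addr_ge0 ?sqr_ge0 // ler_norml.
  have := sqr_ge0 (u x + p x); have := sqr_ge0 (u x - p x).
  have := sqr_ge0 (u x); have := sqr_ge0 (p x); clear; move=> *.
  by apply/andP; split; lra.
(* Real part of the orthogonality relation tested against g. *)
have Re0 : \int[mu]_(x in period_itv) (u x * p x - G x) = 0.
  have := congr1 (@complex.Re R) orth; rewrite /= => <-.
  apply: eq_Rintegral => x _; rewrite /G normc_sqr /p.
  by case: (g x) => a b' /=; ring.
have iuh : mu.-integrable period_itv (EFin \o (fun x => 2^-1 * u x ^+ 2)).
  by apply: (integrableZl _ 2^-1 iu); apply: measurable_itv.
have iGh : mu.-integrable period_itv (EFin \o (fun x => 2^-1 * G x)).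
  by apply: (integrableZl _ 2^-1 iG); apply: measurable_itv.
(* Pointwise, u p - |g|^2 is at most (u^2 - |g|^2) / 2, and the left side integrates to zero. *)
have : 0 <= \int[mu]_(x in period_itv) (2^-1 * u x ^+ 2 - 2^-1 * G x).
  rewrite -Re0; apply: le_Rintegral; first exact: measurable_itv.
  - by apply: (integrableB _ iup iG); apply: measurable_itv.
  - by apply: (integrableB _ iuh iGh); apply: measurable_itv.
  move=> x _; rewrite /G normc_sqr -/(p x); have := sqr_ge0 (u x - p x).
  by have := sqr_ge0 (complex.Im (g x)); clear; lra.
rewrite (RintegralB _ iuh iGh); last exact: measurable_itv.
rewrite (RintegralZl _ _ iu) ?(RintegralZl _ _ iG); try exact: measurable_itv.
rewrite -mulrBr pmulr_rge0 ?invr_gt0 // subr_ge0 -lee_fin /Rintegral.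
by rewrite !fineK //; apply: integrable_fin_num.
Qed.

End Projection.

(** * Reduction of one time step to its Fourier modes *)

Section ModeDecomposition.
Context {R : realType}.
Local Notation normc := ComplexField.Normc.normc.

Lemma wave_bound N (m : 'I_N.*2.+1) : (wave m)%:~R ^+ 2 <= N%:R ^+ 2 :> R.
Proof.
have mN : (m <= N.*2)%N by rewrite -ltnS.
have : `|(wave m)%:~R| <= N%:R :> R.
  rewrite -intr_norm -[N%:R]/(N%:~R) ler_int ler_norml /wave lerBrDr lerBlDr addNr.
  by rewrite -PoszD addnn lez_nat leq0n.
exact: sqr_bound.
Qed.

(** The scheme has real coefficients, so real and imaginary parts pass through its sums; only the
    factor i k in the fluxes exchanges them. *)
Lemma Re_comb (n : nat) (P : pred 'I_n) (z : R[i]) (a : R) (e : 'I_n -> R) (y : 'I_n -> R[i]) :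
  complex.Re (z - a%:C * \sum_(j | P j) (e j)%:C * y j) =
  complex.Re z - a * \sum_(j | P j) e j * complex.Re (y j).
Proof.
have -> (s : R[i]) : complex.Re (z - a%:C * s) = complex.Re z - a * complex.Re s.
  by case: z s => [z1 z2] [s1 s2] /=; ring.
rewrite Re_sum; congr (_ - _ * _); apply: eq_bigr => j _.
by case: (y j) => y1 y2 /=; ring.
Qed.

Lemma Im_comb (n : nat) (P : pred 'I_n) (z : R[i]) (a : R) (e : 'I_n -> R) (y : 'I_n -> R[i]) :
  complex.Im (z - a%:C * \sum_(j | P j) (e j)%:C * y j) =
  complex.Im z - a * \sum_(j | P j) e j * complex.Im (y j).
Proof.
have -> (s : R[i]) : complex.Im (z - a%:C * s) = complex.Im z - a * complex.Im s.
  by case: z s => [z1 z2] [s1 s2] /=; ring.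
rewrite Im_sum; congr (_ - _ * _); apply: eq_bigr => j _.
by case: (y j) => y1 y2 /=; ring.
Qed.

Definition flux_coefU (b : R) N (c d : 'I_N.*2.+1 -> R[i]) m : R[i] :=
  b%:C * (c m * (0 +i* (wave m)%:~R)) + d m * (0 +i* (wave m)%:~R).

Definition flux_coefW (b : R) N (c d : 'I_N.*2.+1 -> R[i]) m : R[i] :=
  (1 - b ^+ 2)%:C * (c m * (0 +i* (wave m)%:~R))
  - b%:C * (d m * (0 +i* (wave m)%:~R)).

Lemma dx_fluxU_trig (b : R) N (c d : 'I_N.*2.+1 -> R[i]) x :
  dx_fluxU b (trig c) (trig d) x = trig (flux_coefU b c d) x.
Proof. by rewrite /dx_fluxU !dx_trig trigZ trigD. Qed.

Lemma dx_fluxW_trig (b : R) N (c d : 'I_N.*2.+1 -> R[i]) x :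
  dx_fluxW b (trig c) (trig d) x = trig (flux_coefW b c d) x.
Proof. by rewrite /dx_fluxW !dx_trig !trigZ trigB. Qed.

Lemma Re_flux_coefU (b : R) N (c d : 'I_N.*2.+1 -> R[i]) m :
  complex.Re (flux_coefU b c d m) =
  - (wave m)%:~R * (b * complex.Im (c m) + complex.Im (d m)).
Proof. by rewrite /flux_coefU; case: (c m) (d m) => [? ?] [? ?] /=; ring. Qed.

Lemma Im_flux_coefU (b : R) N (c d : 'I_N.*2.+1 -> R[i]) m :
  complex.Im (flux_coefU b c d m) =
  (wave m)%:~R * (b * complex.Re (c m) + complex.Re (d m)).
Proof. by rewrite /flux_coefU; case: (c m) (d m) => [? ?] [? ?] /=; ring. Qed.

Lemma Re_flux_coefW (b : R) N (c d : 'I_N.*2.+1 -> R[i]) m :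
  complex.Re (flux_coefW b c d m) =
  - (wave m)%:~R * ((1 - b ^+ 2) * complex.Im (c m) - b * complex.Im (d m)).
Proof. by rewrite /flux_coefW; case: (c m) (d m) => [? ?] [? ?] /=; ring. Qed.

Lemma Im_flux_coefW (b : R) N (c d : 'I_N.*2.+1 -> R[i]) m :
  complex.Im (flux_coefW b c d m) =
  (wave m)%:~R * ((1 - b ^+ 2) * complex.Re (c m) - b * complex.Re (d m)).
Proof. by rewrite /flux_coefW; case: (c m) (d m) => [? ?] [? ?] /=; ring. Qed.

(** Extends the triangular sums of the scheme to full matrix products and collects k dt into
    theta. *)
Lemma sum_flux s (a : 'I_s -> R) (dt k : R) (f : 'I_s -> R) (P : pred 'I_s) :
  (forall j, ~~ P j -> a j = 0) ->
  dt * (\sum_(j | P j) a j * (k * f j)) = k * dt * \sum_j a j * f j.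
Proof.
move=> Pa; rewrite -mulrA mulrCA; congr (_ * _); rewrite mulr_sumr big_mkcond.
apply: eq_bigr => j _; case: ifPn => [_|/Pa ->]; last by rewrite mul0r mulr0.
by rewrite mulrCA.
Qed.

(** Comparing coefficients of mode m turns the step into the real system of [mode_growth_bound],
    with theta = k dt and sigma = dt / eps. *)
Lemma imex_step_energy r (rk : imex_rk R r.+2) (b eps dt K t0 : R) N
    (cU cW cU' cW' : 'I_N.*2.+1 -> R[i]) Us Ws :
  0 < eps -> 0 < dt ->
  mode_growth_bound b rk t0 K ->
  imex_step rk b eps dt N (trig cU) (trig cW) Us Ws (trig cU') (trig cW') ->
  forall m, `|(wave m)%:~R * dt| <= t0 ->
  (1 - b ^+ 2) * normc (cU' m) ^+ 2 + normc (cW' m) ^+ 2 <=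
  (1 + K * ((wave m)%:~R * dt) ^+ 2) *
  ((1 - b ^+ 2) * normc (cU m) ^+ 2 + normc (cW m) ^+ 2).
Proof.
move=> eps0 dt0 growth [PN eqU eqW eqU' eqW'] m tm.
have [cs csE] := choice (fun i => in_PN_trig (PN i).1).
have [ds dsE] := choice (fun i => in_PN_trig (PN i).2).
(* Both sides are coefficients of trigonometric polynomials that agree at every x. *)
have {}eqU i : cs i m = cU m - dt%:C *
    \sum_(j < r.+2 | (j < i)%N) (exA rk i j)%:C * flux_coefU b (cs j) (ds j) m.
  apply: (trig_inj (d := fun m => _)) => x; rewrite -csE eqU.
  under eq_bigr do rewrite csE dsE dx_fluxU_trig trigZ.
  by rewrite trig_sum trigZ trigB.
have {}eqU' : cU' m = cU m - dt%:C *
    \sum_(j < r.+2) (exb rk 0 j)%:C * flux_coefU b (cs j) (ds j) m.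
  apply: (trig_inj (d := fun m => _)) => x; rewrite eqU'.
  under eq_bigr do rewrite csE dsE dx_fluxU_trig trigZ.
  by rewrite trig_sum trigZ trigB.
have {}eqW i : ds i m = cW m
    - dt%:C * (\sum_(j < r.+2 | (j < i)%N) (exA rk i j)%:C * flux_coefW b (cs j) (ds j) m)
    - (dt / eps)%:C * (\sum_(j < r.+2 | (j <= i)%N) (imA rk i j)%:C * ds j m).
  apply: (trig_inj (d := fun m => _)) => x; rewrite -dsE eqW.
  under eq_bigr do rewrite csE dsE dx_fluxW_trig trigZ.
  under [in X in _ - X]eq_bigr do rewrite dsE trigZ.
  by rewrite !trig_sum !trigZ !trigB.
have {}eqW' : cW' m = cW m
    - dt%:C * (\sum_(j < r.+2) (exb rk 0 j)%:C * flux_coefW b (cs j) (ds j) m)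
    - (dt / eps)%:C * (\sum_(j < r.+2) (imb rk 0 j)%:C * ds j m).
  apply: (trig_inj (d := fun m => _)) => x; rewrite eqW'.
  under eq_bigr do rewrite csE dsE dx_fluxW_trig trigZ.
  under [in X in _ - X]eq_bigr do rewrite dsE trigZ.
  by rewrite !trig_sum !trigZ !trigB.
pose U1 := \col_i complex.Re (cs i m) : 'cV[R]_r.+2.
pose U2 := \col_i complex.Im (cs i m) : 'cV[R]_r.+2.
pose W1 := \col_i complex.Re (ds i m) : 'cV[R]_r.+2.
pose W2 := \col_i complex.Im (ds i m) : 'cV[R]_r.+2.
have exA0 (i j : 'I_r.+2) : ~~ (j < i)%N -> exA rk i j = 0.
  by rewrite -leqNgt; apply: exA_strict_trig.
have imA0 (i j : 'I_r.+2) : ~~ (j <= i)%N -> imA rk i j = 0.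
  by rewrite -ltnNge => ij; apply/is_trig_mxP => //; apply: imA_trig.
have imSum (i : 'I_r.+2) (f : 'I_r.+2 -> R) :
    \sum_(j < r.+2 | (j <= i)%N) imA rk i j * f j = \sum_j imA rk i j * f j.
  rewrite big_mkcond; apply: eq_bigr => j _.
  by case: ifPn => // /imA0 ->; rewrite mul0r.
pose th := (wave m)%:~R * dt.
have flux_sum (k : R) (i : 'I_r.+2) (f : 'I_r.+2 -> R) :
    dt * (\sum_(j < r.+2 | (j < i)%N) exA rk i j * (k * f j)) =
    k * dt * \sum_j exA rk i j * f j.
  by apply: sum_flux => j; apply: exA0.
have flux_sumT (k : R) (f : 'I_r.+2 -> R) :
    dt * (\sum_j exb rk 0 j * (k * f j)) = k * dt * \sum_j exb rk 0 j * f j.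
  by apply: sum_flux.
have sigma0 : 0 <= dt / eps by rewrite divr_ge0 // ltW.
have := growth th (dt / eps) (complex.Re (cU m)) (complex.Im (cU m))
  (complex.Re (cW m)) (complex.Im (cW m)) U1 U2 W1 W2 sigma0 tm.
have sumE n (A : 'M[R]_(n, r.+2)) (x : 'cV[R]_r.+2) i (f : 'I_r.+2 -> R) :
    (forall j, x j 0 = f j) -> (A *m x) i 0 = \sum_j A i j * f j.
  by move=> xf; rewrite mxE; apply: eq_bigr => j _; rewrite xf.
have F1E j : (b *: U1 + W1) j 0 = b * complex.Re (cs j m) + complex.Re (ds j m).
  by rewrite !mxE.
have F2E j : (b *: U2 + W2) j 0 = b * complex.Im (cs j m) + complex.Im (ds j m).
  by rewrite !mxE.
have G1E j : ((1 - b ^+ 2) *: U1 - b *: W1) j 0 =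
    (1 - b ^+ 2) * complex.Re (cs j m) - b * complex.Re (ds j m) by rewrite !mxE.
have G2E j : ((1 - b ^+ 2) *: U2 - b *: W2) j 0 =
    (1 - b ^+ 2) * complex.Im (cs j m) - b * complex.Im (ds j m) by rewrite !mxE.
have W1E j : W1 j 0 = complex.Re (ds j m) by rewrite mxE.
have W2E j : W2 j 0 = complex.Im (ds j m) by rewrite mxE.
(* Multiplication by i k sends the imaginary part of the flux to the real equation with a change of
   sign, hence [U2], [W2] and a plus sign here. *)
have eU1 : U1 = const_mx (complex.Re (cU m)) + th *: (exA rk *m (b *: U2 + W2)).
  apply/colP => i; rewrite mxE eqU Re_comb [RHS]mxE [X in _ = X + _]mxE [X in _ = _ + X]mxE.
  under eq_bigr do rewrite Re_flux_coefU.
  by rewrite flux_sum (sumE _ _ _ _ _ F2E) /th !mulNr opprK.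
have eU2 : U2 = const_mx (complex.Im (cU m)) - th *: (exA rk *m (b *: U1 + W1)).
  apply/colP => i; rewrite mxE eqU Im_comb [RHS]mxE [X in _ = X + _]mxE [X in _ = _ + X]mxE.
  under eq_bigr do rewrite Im_flux_coefU.
  by rewrite flux_sum [X in _ = _ - X]mxE (sumE _ _ _ _ _ F1E) /th.
have eW1 : W1 = const_mx (complex.Re (cW m))
    + th *: (exA rk *m ((1 - b ^+ 2) *: U2 - b *: W2)) - (dt / eps) *: (imA rk *m W1).
  apply/colP => i; rewrite mxE eqW !Re_comb [RHS]mxE [X in _ = X + _]mxE.
  rewrite [X in _ = X + _ + _]mxE [X in _ = _ + X + _]mxE [X in _ = _ + X]mxE.
  rewrite [X in _ = _ - X]mxE (sumE _ _ _ _ _ W1E) imSum (sumE _ _ _ _ _ G2E).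
  under eq_bigr do rewrite Re_flux_coefW.
  by rewrite flux_sum /th !mulNr opprK.
have eW2 : W2 = const_mx (complex.Im (cW m))
    - th *: (exA rk *m ((1 - b ^+ 2) *: U1 - b *: W1)) - (dt / eps) *: (imA rk *m W2).
  apply/colP => i; rewrite mxE eqW !Im_comb [RHS]mxE [X in _ = X + _]mxE.
  rewrite [X in _ = X + _ + _]mxE [X in _ = _ + X + _]mxE [X in _ = _ + X]mxE.
  rewrite [X in _ = _ - X]mxE (sumE _ _ _ _ _ W2E) imSum.
  rewrite [X in _ = _ - X + _]mxE (sumE _ _ _ _ _ G1E).
  under eq_bigr do rewrite Im_flux_coefW.
  by rewrite flux_sum /th.
move=> /(_ eU1 eU2 eW1 eW2).
rewrite (sumE _ _ _ _ _ F1E) (sumE _ _ _ _ _ F2E) (sumE _ _ _ _ _ G1E).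
rewrite (sumE _ _ _ _ _ G2E) (sumE _ _ _ _ _ W1E) (sumE _ _ _ _ _ W2E).
have -> : complex.Re (cU m) + th * \sum_j exb rk 0 j *
    (b * complex.Im (cs j m) + complex.Im (ds j m)) = complex.Re (cU' m).
  rewrite eqU' Re_comb; under [in RHS]eq_bigr do rewrite Re_flux_coefU.
  by rewrite flux_sumT /th !mulNr opprK.
have -> : complex.Im (cU m) - th * \sum_j exb rk 0 j *
    (b * complex.Re (cs j m) + complex.Re (ds j m)) = complex.Im (cU' m).
  rewrite eqU' Im_comb; under [in RHS]eq_bigr do rewrite Im_flux_coefU.
  by rewrite flux_sumT /th.
have -> : complex.Re (cW m) + th * \sum_j exb rk 0 j *
    ((1 - b ^+ 2) * complex.Im (cs j m) - b * complex.Im (ds j m))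
    - dt / eps * \sum_j imb rk 0 j * complex.Re (ds j m) = complex.Re (cW' m).
  rewrite eqW' !Re_comb; congr (_ - _).
  under [in RHS]eq_bigr do rewrite Re_flux_coefW.
  by rewrite flux_sumT /th !mulNr opprK.
have -> : complex.Im (cW m) - th * \sum_j exb rk 0 j *
    ((1 - b ^+ 2) * complex.Re (cs j m) - b * complex.Re (ds j m))
    - dt / eps * \sum_j imb rk 0 j * complex.Im (ds j m) = complex.Im (cW' m).
  rewrite eqW' !Im_comb; congr (_ - _).
  under [in RHS]eq_bigr do rewrite Im_flux_coefW.
  by rewrite flux_sumT /th.
by rewrite -!normc_sqr.
Qed.

End ModeDecomposition.

(** * Uniform stability up to time T *)

Theorem theorem3p4 (R : realType) (b : R) (r : nat) (rk : imex_rk R r.+2)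
    (hb : `|b| < 1) (hCK : type_CK rk) (hISA : ISA rk)
    (hM : exists M : 'M[R]_r.+2, condM1 rk M /\ condM2 M)
    (cCFL T : R) (hCFL : 0 < cCFL) (hT : 0 < T) :
  exists c C : R, [/\ 0 < c, 0 < C &
    forall (eps : R) (N : nat) (dt : R) (uin win : R -> R),
      0 < eps -> (1 <= N)%N -> 0 < dt ->
      dt <= Num.min (cCFL / N%:R ^+ 2) c ->
      (forall x, uin (x + 2 * pi) = uin x) ->
      (forall x, win (x + 2 * pi) = win x) ->
      L2fun uin -> L2fun win ->
      forall U W : nat -> R -> R[i],
        imex_solution rk b eps dt N uin win U W ->
        forall n : nat, n%:R * dt <= T ->
          (energy b (U n) (W n) <=
           C%:E * energy b (fun x => (uin x)%:C) (fun x => (win x)%:C))%E].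
Proof.
have [M [cM1 cM2]] := hM.
have [t0 [K [t00 K0 growth]]] := mode_growth hb hCK hISA cM1 cM2.
(* This c makes theta^2 <= c_CFL dt <= t0^2, so every mode is within the range of [mode_growth]. C
   is the total amplification up to time T. *)
exists (t0 ^+ 2 / cCFL), (expR (K * cCFL * T)).
split; [by rewrite divr_gt0 ?exprn_gt0 | exact: expR_gt0 |].
move=> eps N dt uin win eps0 N1 dt0; rewrite le_min => /andP[dtN dtc] _ _ L2u L2w.
move=> U W [projU projW sol] n nT.
have beta0 : 0 <= 1 - b ^+ 2.
  by rewrite subr_ge0 -real_normK ?num_real // expr_le1 // ltW.
have [cs csE] := choice (fun n => in_PN_trig (let: And3 p _ _ := sol n in p)).
have [ds dsE] := choice (fun n => in_PN_trig (let: And3 _ p _ := sol n in p)).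
pose E n := \sum_j ((1 - b ^+ 2) * ComplexField.Normc.normc (cs n j) ^+ 2
                    + ComplexField.Normc.normc (ds n j) ^+ 2).
have energyE k : energy b (U k) (W k) = (2 * pi * E k)%:E.
  by rewrite csE dsE energy_trig.
have mode_ge0 (x y : R) : 0 <= (1 - b ^+ 2) * x ^+ 2 + y ^+ 2.
  by rewrite addr_ge0 ?sqr_ge0 // mulr_ge0 ?sqr_ge0.
have E0 k : 0 <= E k.
  by apply: sumr_ge0 => j _; apply: mode_ge0.
have theta_sqr (m : 'I_N.*2.+1) : ((wave m)%:~R * dt) ^+ 2 <= cCFL * dt.
  rewrite exprMn; apply: (@le_trans _ _ (N%:R ^+ 2 * dt ^+ 2)).
    by rewrite ler_wpM2r ?sqr_ge0 // wave_bound.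
  rewrite [dt ^+ 2]expr2 mulrA ler_wpM2r ?(ltW dt0) //.
  by rewrite mulrC -ler_pdivlMr // exprn_gt0 // ltr0n.
have theta_le (m : 'I_N.*2.+1) : `|(wave m)%:~R * dt| <= t0.
  rewrite -(@ler_pXn2r _ 2) ?nnegrE ?(ltW t00) // real_normK ?num_real //.
  apply: le_trans (theta_sqr m) _.
  by rewrite mulrC -ler_pdivlMr.
(* Each mode grows by at most 1 + K theta^2 <= exp (K c_CFL dt), a factor common to all modes, so
   the bound sums up. *)
have E_step k : E k.+1 <= expR (K * cCFL * dt) * E k.
  rewrite mulr_sumr; apply: ler_sum => m _.
  have [_ _ [Us [Ws step]]] := sol k.
  rewrite !csE !dsE in step.
  apply: le_trans (imex_step_energy eps0 dt0 growth step (theta_le m)) _.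
  apply: ler_wpM2r (mode_ge0 _ _) _ _ _.
  apply: le_trans (expR_ge1Dx _); rewrite lerD2l -mulrA.
  by rewrite ler_wpM2l.
have E_bound k : E k <= expR (K * cCFL * (k%:R * dt)) * E 0%N.
  elim: k => [|k IHk]; first by rewrite mul0r mulr0 expR0 mul1r.
  apply: le_trans (E_step k) _.
  rewrite -natr1 mulrDl mul1r mulrDr expRD [leRHS]mulrAC [leRHS]mulrC.
  by rewrite ler_wpM2l // expR_ge0.
have [c cE cU] := projPN_contraction L2u projU.
have [d dE dW] := projPN_contraction L2w projW.
(* First the growth from time 0, using n dt <= T, then the contraction of the projection on both
   initial data. *)
apply: (@le_trans _ _ ((expR (K * cCFL * T))%:E * energy b (U 0%N) (W 0%N))%E).
  rewrite !energyE -EFinM lee_fin mulrCA ler_wpM2l ?mulr_ge0 ?pi_ge0 //.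
  apply: le_trans (E_bound n) _; rewrite ler_wpM2r // ler_expR ler_wpM2l //.
  by rewrite mulr_ge0 // ltW.
rewrite lee_wpmul2l ?lee_fin ?expR_ge0 // leeD //.
by rewrite lee_wpmul2l ?lee_fin.
Qed.
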